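(* Let $d\geq 1$ be an integer and let $\Theta\in\{\max,\ \mathrm{prod}^{1/d}\}$, where $\max(\mathbf{q})=\max(q_1,\dots,q_d)$ and $\mathrm{prod}^{1/d}(\mathbf{q})=(q_1q_2\cdots q_d)^{1/d}$ for $\mathbf{q}=(q_1,\dots,q_d)\in\mathbb{N}^d$. For $\tau>0$ let \[ S_\Theta(\tau)=\Big\{\mathbf{x}\in\mathbb{R}^d:\ |x_i-p_i/q_i|<\Theta(\mathbf{q})^{-\tau}\ (i=1,\dots,d)\ \text{for infinitely many } (p_1/q_1,\dots,p_d/q_d)\in\mathbb{Q}^d\Big\}, \] where each $p_i/q_i$ is in lowest terms with $p_i\in\mathbb{Z}$, $q_i\in\mathbb{N}$, and $\mathbf{q}=(q_1,\dots,q_d)$. Then for all $\tau\geq 2$, \[ \dim_H\big(S_\Theta(\tau)\big)=\frac{2d}{\tau}. \]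
   Context: $\dim_H$ denotes Hausdorff dimension. *)

(* Defs.v *)
From mathcomp Require Export all_boot all_order all_algebra.
From mathcomp Require Export all_classical all_reals all_analysis.

Set Implicit Arguments.
Unset Strict Implicit.
Unset Printing Implicit Defensive.

Import Order.TTheory GRing.Theory Num.Theory.

Local Open Scope classical_set_scope.
Local Open Scope ring_scope.

Section Hausdorff.
Context {R : realType} {T : Type} (dist : T -> T -> R).
Local Open Scope ereal_scope.

(* diameter of a nonempty set; -oo on set0 *)
Definition diameter (U : set T) : \bar R :=
  ereal_sup [set z | exists x y, [/\ U x, U y & z = (dist x y)%:E]].

(* Empty sets are singled out so that they contribute 0 also when s = 0,
   while nonempty sets then contribute 1 (counting measure). *)
Definition gauge (s : R) (U : set T) : \bar R :=
  if U == set0 then 0 else diameter U `^ s.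

Definition delta_cover (delta : R) (A : set T) (U : nat -> set T) : Prop :=
  A `<=` \bigcup_n U n /\ forall n, diameter (U n) <= delta%:E.

Definition hausdorff_premeasure (s delta : R) (A : set T) : \bar R :=
  ereal_inf [set \sum_(0 <= n <oo) gauge s (U n) | U in delta_cover delta A].

(* The premeasure is nonincreasing in delta, so the supremum is the limit as
   delta tends to 0. *)
Definition hausdorff_measure (s : R) (A : set T) : \bar R :=
  ereal_sup [set hausdorff_premeasure s delta A | delta in [set e | (0 < e)%R]].

Definition hausdorff_dim (A : set T) : \bar R :=
  ereal_inf [set s%:E | s in [set s | (0 <= s)%R /\ hausdorff_measure s A = 0]].

End Hausdorff.

Section Approximation.
Context {R : realType} {d : nat}.

Definition euclidean_dist (x y : 'rV[R]_d) : R :=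
  Num.sqrt (\sum_(i < d) (x ord0 i - y ord0 i) ^+ 2).

Definition theta_max (q : 'I_d -> nat) : R := (\max_(i < d) q i)%:R.

Definition theta_prod (q : 'I_d -> nat) : R :=
  (\prod_(i < d) q i)%:R `^ (d%:R^-1).

(* denq is the positive denominator of a rational in lowest terms *)
Definition denominators (r : 'rV[rat]_d) (i : 'I_d) : nat :=
  `|denq (r ord0 i)|%N.

Definition S_ (Theta : ('I_d -> nat) -> R) (tau : R) : set 'rV[R]_d :=
  [set x | infinite_set
     [set r : 'rV[rat]_d | forall i : 'I_d,
        `|x ord0 i - ratr (r ord0 i)| < Theta (denominators r) `^ (- tau)]].

End Approximation.

(* Main.v *)
Require Import Defs.
From mathcomp Require Import zify ring lra.

Set Implicit Arguments.
Unset Strict Implicit.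
Unset Printing Implicit Defensive.

Import Order.TTheory GRing.Theory Num.Theory.
Import numFieldNormedType.Exports.

Local Open Scope classical_set_scope.
Local Open Scope ring_scope.

(** Since [prod^(1/d) <= max], the set for [max] is contained in the one for
    [prod^(1/d)], so it suffices to bound the dimension of the former from below
    and that of the latter from above.

    Lower bound, for [s = u d] with [u < 2 / tau]: for a rapidly growing sequence
    [Q_k], every rational with denominator at most [Q_k] has about
    [Q_k^-tau Q_(k+1)^2] rationals with denominator at most [Q_(k+1)] within
    distance [Q_k^-tau / 4], and these are [Q_(k+1)^-2]-separated. Iterating gives
    a tree of rationals in which an interval of length [e] contains a proportion
    [O(e^u)] of the nodes of every level whose scale is finer than [e]. Limits of
    [d]-tuples of nodes of the same level lie in the set for [max], whose
    [s]-dimensional measure is positive by the mass distribution principle.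

    Upper bound, for [s > 2 d / tau]: give a rational vector with entries
    [p_i / q_i] the weight [prod_i (q_i (1 + |p_i|))^-kappa], where [kappa > 1]
    and [2 kappa < tau s / d]. The weights are summable over all of [Q^d], and
    near any given point they dominate any constant multiple of
    [(prod_i q_i)^(- tau s / d)], the [s]-th power of the radius of the box around
    the vector, once [prod_i q_i] is large. The boxes for which this happens form
    covers with arbitrarily small sums. *)

(** * Families with bounded finite sums *)

Definition bounded_sums {R : numDomainType} {J : eqType} (w : J -> R) : Prop :=
  exists K, forall js : seq J, uniq js -> \sum_(j <- js) w j <= K.

Section BoundedSums.
Context {R : realDomainType}.

Lemma ler_sum_uniq_sub (J : eqType) (w : J -> R) (s t : seq J) :
  (forall j, 0 <= w j) -> uniq s -> uniq t -> {subset s <= t} ->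
  \sum_(j <- s) w j <= \sum_(j <- t) w j.
Proof.
move=> w0 us ut st; rewrite [leRHS](bigID (mem s)) /= -[X in X + _]big_filter.
rewrite [X in _ <= X + _](perm_big s) /=; first by rewrite lerDl sumr_ge0.
apply: uniq_perm => //; first exact: filter_uniq.
by move=> j; rewrite mem_filter; case: (boolP (j \in s)) => [/st ->|].
Qed.

Lemma bounded_sums_finType (J : finType) (w : J -> R) :
  (forall j, 0 <= w j) -> bounded_sums w.
Proof.
move=> w0; exists (\sum_j w j) => js ujs; rewrite -[leRHS]big_enum.
by apply: ler_sum_uniq_sub => //; [exact: enum_uniq|move=> j; rewrite mem_enum].
Qed.

Lemma bounded_sums_inj (J L : eqType) (h : J -> L) (v : J -> R) (w : L -> R) :
  injective h -> (forall j, v j <= w (h j)) -> bounded_sums w -> bounded_sums v.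
Proof.
move=> h_inj vw [K wK]; exists K => js ujs.
apply: le_trans (wK (map h js) _); last by rewrite map_inj_uniq.
by rewrite big_map ler_sum.
Qed.

Lemma bounded_sums_pair (J L : eqType) (v : J -> R) (w : L -> R) :
  (forall j, 0 <= v j) -> (forall l, 0 <= w l) ->
  bounded_sums v -> bounded_sums w -> bounded_sums (fun jl => v jl.1 * w jl.2).
Proof.
move=> v0 w0 [K vK] [M wM]; exists (K * M) => js ujs.
pose s := undup (unzip1 js); pose t := undup (unzip2 js).
apply: (@le_trans _ _
    (\sum_(jl <- [seq (j, l) | j <- s, l <- t]) v jl.1 * w jl.2)).
  apply: ler_sum_uniq_sub => //; first by move=> jl; exact: mulr_ge0.
    by apply: allpairs_uniq => //; rewrite ?undup_uniq// => -[? ?] [? ?].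
  move=> [j l] jl; apply/allpairsP; exists (j, l); rewrite !mem_undup.
  by split; rewrite //; apply/mapP; exists (j, l).
rewrite big_allpairs /= -big_distrlr /=.
by apply: ler_pM; rewrite ?sumr_ge0 ?vK ?wM ?undup_uniq.
Qed.

Lemma bounded_sums_row (J : eqType) (w : J -> R) (d : nat) :
  (forall j, 0 <= w j) -> bounded_sums w ->
  bounded_sums (fun r : 'rV[J]_d => \prod_i w (r ord0 i)).
Proof.
move=> w0 bw; elim: d => [|d IH].
  apply: (@bounded_sums_inj _ unit (fun=> tt) _ (fun=> 1)).
  - by move=> r s _; apply/rowP => -[].
  - by move=> r; rewrite big_ord0.
  - by apply: bounded_sums_finType => _; exact: ler01.
pose split (r : 'rV[J]_d.+1) := (r ord0 ord0, \row_i r ord0 (lift ord0 i)).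
apply: (@bounded_sums_inj _ _ split _
  (fun jr => w jr.1 * \prod_i w (jr.2 ord0 i))).
- move=> r s [r0 /rowP rs]; apply/rowP => i; have [j ->|->//] := unliftP ord0 i.
  by have := rs j; rewrite !mxE.
- move=> r; rewrite big_ord_recl [leRHS]/=.
  under [in leRHS]eq_bigr => i _ do rewrite mxE.
  exact: lexx.
- apply: (bounded_sums_pair
    (w := fun r : 'rV[J]_d => \prod_i w (r ord0 i))) => // r.
  exact: prodr_ge0.
Qed.

End BoundedSums.

Lemma finite_ge_bounded_sums (R : realType) (J : choiceType) (w : J -> R)
    (c : R) :
  0 < c -> bounded_sums w -> finite_set [set j | c <= w j].
Proof.
move=> c0 [K wK]; apply: contrapT => /infinite_set_fset.
move=> /(_ (Num.trunc (K / c)).+1)[js js_ge size_js].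
have := wK _ (finmap.fset_uniq js); apply/negP; rewrite -ltNge.
apply: (@lt_le_trans _ _ (\sum_(j <- finmap.enum_fset js) c)); last first.
  by rewrite big_seq [leRHS]big_seq; apply: ler_sum => j /js_ge.
rewrite big_const_seq count_predT iter_addr_0 -mulr_natr mulrC -ltr_pdivrMr//.
by apply: lt_le_trans (truncnS_gt _) _; rewrite ler_nat.
Qed.

(** * Hausdorff measure and dimension *)

Section HausdorffMeasure.
Context {R : realType} {T : Type} (dist : T -> T -> R).
Local Open Scope ereal_scope.
Implicit Types (U A B : set T) (s t : R).

Lemma diameter_set0 : diameter dist set0 = -oo.
Proof. by apply/ereal_sup_ninfty => z [x [y []]]. Qed.

Lemma gauge_set0 s : gauge dist s set0 = 0.
Proof. by rewrite /gauge eqxx. Qed.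

Lemma gauge_nonempty s U (D : R) : U !=set0 -> diameter dist U = D%:E ->
  gauge dist s U = (D `^ s)%:E.
Proof. by move=> /set0P/negPf U0 UD; rewrite /gauge U0 UD poweR_EFin. Qed.

Lemma gauge_ge0 s U : 0 <= gauge dist s U.
Proof. by rewrite /gauge; case: ifP => // _; exact: poweR_ge0. Qed.

Lemma hausdorff_measure_ge0 s A : 0 <= hausdorff_measure dist s A.
Proof.
apply: le_ereal_sup_tmp; exists (hausdorff_premeasure dist s 1 A).
  by exists 1%R => //=.
apply: le_ereal_inf_tmp => _ [U _ <-].
by apply: nneseries_ge0 => n _ _; exact: gauge_ge0.
Qed.

Lemma hausdorff_measure_subset s A B : A `<=` B ->
  hausdorff_measure dist s A <= hausdorff_measure dist s B.
Proof.
move=> AB; apply: ge_ereal_sup => _ [delta /= delta0 <-].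
apply: le_ereal_sup_tmp; exists (hausdorff_premeasure dist s delta B).
  by exists delta.
apply: le_ereal_inf => _ [U [BU Udelta] <-]; exists U => //.
by split => //; exact: subset_trans BU.
Qed.

Lemma hausdorff_dim_subset A B : A `<=` B ->
  hausdorff_dim dist A <= hausdorff_dim dist B.
Proof.
move=> AB; apply: le_ereal_inf => _ [s [s0 B0] <-]; exists s => //; split => //.
apply/eqP; rewrite eq_le hausdorff_measure_ge0 andbT -B0.
exact: hausdorff_measure_subset.
Qed.

Lemma hausdorff_dim_le t A : (0 <= t)%R ->
  (forall s, (t < s)%R -> hausdorff_measure dist s A = 0) ->
  hausdorff_dim dist A <= t%:E.
Proof.
move=> t0 A0; apply/lee_addgt0Pr => e e0; apply: ereal_inf_lbound.
exists (t + e)%R; last by rewrite EFinD.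
by split; [lra|apply: A0; lra].
Qed.

Lemma hausdorff_measure_eq0 (J : countType) (E : J -> set T) (w : J -> R)
    s A :
  (forall j, 0 <= w j)%R -> bounded_sums w ->
  (forall (eps delta : R) x, (0 < eps)%R -> (0 < delta)%R -> A x ->
    exists j, [/\ E j x, diameter dist (E j) <= delta%:E &
      gauge dist s (E j) <= (eps * w j)%:E]) ->
  hausdorff_measure dist s A = 0.
Proof.
move=> w0 [K wK] smallE; apply/eqP; rewrite eq_le hausdorff_measure_ge0 andbT.
apply: ge_ereal_sup => _ [delta /= delta0 <-].
apply/lee_addgt0Pr => e e0; rewrite add0e.
have K0 : (0 <= K)%R by have := wK [::] isT; rewrite big_nil.
pose eps := (e / (K + 1))%R.
have eps0 : (0 < eps)%R by rewrite divr_gt0// ltr_wpDl.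
pose good j := `[< diameter dist (E j) <= delta%:E /\
  gauge dist s (E j) <= (eps * w j)%:E >].
pose U n :=
  if pickle_inv n is Some j then if good j then E j else set0 else set0.
have gauge_U n : gauge dist s (U n) <=
    (oapp (fun j => eps * w j)%R 0%R (pickle_inv n))%:E.
  rewrite /U; case: pickle_inv => [j|] /=; last by rewrite gauge_set0.
  case: ifPn => [/asboolP[]//|_]; rewrite gauge_set0 lee_fin.
  by rewrite mulr_ge0// ltW.
apply: (@le_trans _ _ (\sum_(0 <= n <oo) gauge dist s (U n))).
  apply: ereal_inf_lbound; exists U => //; split => [x Ax|n].
    have [j [xj diam_j gauge_j]] := smallE _ _ _ eps0 delta0 Ax.
    by exists (pickle j) => //; rewrite /U pickleK_inv ifT//; exact/asboolP.
  rewrite /U; case: pickle_inv => [j|]; last by rewrite diameter_set0 leNye.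
  by case: ifPn => [/asboolP[]//|_]; rewrite diameter_set0 leNye.
apply: lime_le; first by apply: is_cvg_nneseries => n _ _; exact: gauge_ge0.
apply: nearW => N; apply: (le_trans (lee_sum _ (fun n _ => gauge_U n))).
rewrite sumEFin lee_fin -(@big_pmap _ _ _ _ _ pickle_inv) -mulr_sumr.
rewrite /eps mulrAC ler_pdivrMr ?ltr_wpDl// ler_pM2l//.
apply: le_trans (wK _ (pmap_uniq pickle_invK (iota_uniq _ _))) _.
by rewrite lerDl.
Qed.

Hypothesis dist_ge0 : forall x y, (0 <= dist x y)%R.

Lemma diameter_bounded U (delta : R) :
  U !=set0 -> diameter dist U <= delta%:E ->
  exists D : R, [/\ diameter dist U = D%:E, (0 <= D)%R &
    forall x y, U x -> U y -> (dist x y <= D)%R].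
Proof.
move=> [x Ux].
have dist_le y z : U y -> U z -> (dist y z)%:E <= diameter dist U.
  by move=> Uy Uz; apply: ereal_sup_ubound; exists y, z.
have := dist_le x x Ux Ux.
case: (diameter dist U) dist_le => // D dist_le; rewrite lee_fin => xD _.
by exists D; split => //; exact: le_trans xD.
Qed.

Lemma gauge_le_powR s U (D : R) : (0 <= s)%R -> diameter dist U <= D%:E ->
  gauge dist s U <= (D `^ s)%:E.
Proof.
move=> s0 UD; have [->|/set0P U0] := eqVneq U set0.
  by rewrite gauge_set0 lee_fin powR_ge0.
have [E [UE E0 _]] := diameter_bounded U0 UD.
rewrite (gauge_nonempty _ U0 UE) lee_fin.
have ED : (E <= D)%R by rewrite -lee_fin -UE.
by rewrite ge0_ler_powR ?nnegrE// (le_trans E0).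
Qed.

Lemma gauge_le_exponent s t U : (0 <= s <= t)%R -> diameter dist U <= 1 ->
  gauge dist t U <= gauge dist s U.
Proof.
move=> /andP[s0 st] U1; have [->|/set0P U0] := eqVneq U set0.
  by rewrite !gauge_set0.
have [D [UD D0 _]] := diameter_bounded U0 U1.
rewrite !(gauge_nonempty _ U0 UD) lee_fin.
have D1 : (D <= 1)%R by rewrite -lee_fin -UD.
move: s0; rewrite le_eqVlt => /predU1P[s0|s0].
  have : (D `^ t <= 1 `^ t)%R by rewrite ge0_ler_powR ?nnegrE//; lra.
  by rewrite -s0 powRr0 powR1.
move: D0; rewrite le_eqVlt => /predU1P[<-|D0]; last by rewrite ger_powR ?D0.
by rewrite !powR0//; lra.
Qed.

Lemma hausdorff_measure_le_exponent s t A : (0 <= s <= t)%R ->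
  hausdorff_measure dist t A <= hausdorff_measure dist s A.
Proof.
move=> st; apply: ge_ereal_sup => _ [delta /= delta0 <-].
apply: le_ereal_sup_tmp.
exists (hausdorff_premeasure dist s (Num.min delta 1%R) A).
  by exists (Num.min delta 1%R) => //=; rewrite lt_min delta0 ltr01.
apply: le_ereal_inf_tmp => _ [U [AU Udelta] <-].
apply: (@le_trans _ _ (\sum_(0 <= n <oo) gauge dist t (U n))).
  apply: ereal_inf_lbound; exists U => //; split => // n.
  by apply: le_trans (Udelta n) _; rewrite lee_fin ge_min lexx.
apply: lee_nneseries => n *; first exact: gauge_ge0.
apply: gauge_le_exponent => //; apply: le_trans (Udelta n) _.
by rewrite lee_fin ge_min lexx orbT.
Qed.

Lemma hausdorff_dim_ge t A :
  (forall s, (0 < s < t)%R -> 0 < hausdorff_measure dist s A) ->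
  t%:E <= hausdorff_dim dist A.
Proof.
move=> A0; apply: le_ereal_inf_tmp => _ [s [s0 As] <-].
rewrite lee_fin leNgt; apply/negP => st.
have : 0 < hausdorff_measure dist ((s + t) / 2) A by apply: A0; lra.
rewrite ltNge => /negP; apply; rewrite -As.
by apply: hausdorff_measure_le_exponent; lra.
Qed.

End HausdorffMeasure.

(** * The mass distribution principle *)

Lemma powR_add_root (R : realType) (D s eta : R) :
  0 <= D -> 0 < s -> 0 < eta -> exists2 r, D < r & r `^ s = D `^ s + eta.
Proof.
move=> D0 s0 eta0.
have Ds_eta : 0 <= D `^ s + eta by rewrite addr_ge0 ?powR_ge0// ltW.
have rs : ((D `^ s + eta) `^ s^-1) `^ s = D `^ s + eta.
  by rewrite -powRrM mulVf ?gt_eqF// powRr1.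
exists ((D `^ s + eta) `^ s^-1) => //; rewrite ltNge; apply/negP => r_le.
have : ((D `^ s + eta) `^ s^-1) `^ s <= D `^ s.
  by rewrite ge0_ler_powR ?nnegrE ?powR_ge0// ltW.
by rewrite rs; lra.
Qed.

Section MassDistribution.
Context {R : realType} {T : pseudoMetricType R} (dist : T -> T -> R).
Hypothesis dist_ge0 : forall x y, 0 <= dist x y.
Hypothesis dist_lt_ball : forall x y e, dist x y < e -> ball x e y.
Context (I : nat -> finType) (x : forall k, I k -> T).

Definition level_points (n : nat) : set T :=
  \bigcup_(k in [set k | (n <= k)%N]) range (@x k).

Definition kuratowski_limsup : set T := \bigcap_n closure (level_points n).

Definition level_mass (k : nat) (V : set T) : R :=
  #|[set i : I k | x i \in V]%SET|%:R / #|I k|%:R.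

Hypothesis I_gt0 : forall k, (0 < #|I k|)%N.

Lemma level_mass_bigcup_ge1 k (N : nat) (V : nat -> set T) :
  (forall i : I k, exists2 n, (n < N)%N & V n (x i)) ->
  1 <= \sum_(n < N) level_mass k (V n).
Proof.
move=> cover; rewrite -mulr_suml ler_pdivlMr ?ltr0n// mul1r -natr_sum ler_nat.
under eq_bigr => n _ do rewrite -sum1_card big_mkcond /=.
rewrite exchange_big -sum1_card; apply: leq_sum => i _.
have [n nN Vn] := cover i.
by rewrite (bigD1 (Ordinal nN))//= !inE mem_set.
Qed.

Lemma compact_finite_level_cover (B : set T) (V : nat -> set T) :
  compact B -> (forall k (i : I k), B (x i)) -> (forall n, open (V n)) ->
  kuratowski_limsup `<=` \bigcup_n V n ->
  exists N, forall k (i : I k), (N <= k)%N -> exists2 n, (n < N)%N & V n (x i).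
Proof.
move=> cptB xB oV cover; apply: contrapT => noN.
have /choice[y yP] : forall N, exists y,
    level_points N y /\ forall n, (n < N)%N -> ~ V n y.
  move=> N; apply: contrapT => noy; apply: noN; exists N => k i Nk.
  apply: contrapT => noV; apply: noy; exists (x i).
  by split=> [|n nN Vn]; [exists k => //; exists i|apply: noV; exists n].
have [|p [_ clp]] := cptB (y @ \oo).
  exists 0%N => // N _ /=; have [[k _ [i _ <-]] _] := yP N; exact: xB.
have [|n _ Vp] := cover p.
  move=> N _ W /clp; apply; exists N => // M /= NM.
  by have [[k Mk [i _ <-]] _] := yP M; exists k; [exact: leq_trans Mk|exists i].
have [||z [nVz Vz]] := clp (~` V n) (V n); last exact: nVz Vz.
- by exists n.+1 => // N /= nN; have [_ /(_ n nN)] := yP N.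
- by apply: open_nbhs_nbhs; split; first exact: oV.
Qed.

Context (C s : R) (rho : nat -> R).
Hypothesis (C_gt0 : 0 < C) (s_gt0 : 0 < s).
Hypothesis rho0 : rho @ \oo --> 0.
Hypothesis level_mass_ball_le : forall k y e,
  rho k <= e -> level_mass k (ball y e) <= C * e `^ s.

Lemma dist_le_interior_ball (y z : T) (D r : R) :
  D < r -> dist y z <= D -> (ball y r)^° z.
Proof.
move=> Dr yz; apply/nbhs_ballP; exists ((r - D) / 2); first by rewrite /=; lra.
move=> z' zz'; rewrite (_ : r = (r + D) / 2 + (r - D) / 2); last by field.
by apply: ball_triangle zz'; apply: dist_lt_ball; lra.
Qed.

(* A set of diameter [D] lies in an open ball of radius [r], where
   [r `^ s = D `^ s + eta]. *)
Lemma level_mass_open_cover (U : set T) (delta eta : R) :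
  (diameter dist U <= delta%:E)%E -> 0 < eta ->
  exists V, [/\ open V, U `<=` V & \forall k \near \oo,
    ((level_mass k V)%:E <= C%:E * (gauge dist s U + eta%:E))%E].
Proof.
move=> Udelta eta0; have [->|/set0P U0] := eqVneq U set0.
  exists set0; split => //; first exact: open0.
  apply: nearW => k; rewrite gauge_set0 add0e -EFinM lee_fin /level_mass.
  rewrite (_ : finset _ = finset.set0) ?cards0 ?mul0r ?mulr_ge0 ?ltW//.
  by apply/setP => i; rewrite !inE in_set0.
have [D [UD D0 distD]] := diameter_bounded dist_ge0 U0 Udelta.
have [y Uy] := U0; have [r Dr rs] := powR_add_root D0 s_gt0 eta0.
exists (ball y r)^°; split; first exact: open_interior.
- by move=> z Uz; apply: dist_le_interior_ball Dr _; exact: distD.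
- have near_le : \forall k \near \oo, rho k <= r.
    exact: cvgr_le rho0 _ (le_lt_trans D0 Dr).
  apply: filterS near_le => k kr.
  rewrite (gauge_nonempty _ U0 UD) -EFinD -EFinM lee_fin -rs.
  apply: le_trans (level_mass_ball_le _ kr); rewrite ler_wpM2r// ler_nat.
  apply: subset_leq_card; apply/fintype.subsetP => i.
  by rewrite !inE; exact: interior_subset.
Qed.

Lemma mass_distribution (B A : set T) :
  compact B -> (forall k (i : I k), B (x i)) -> kuratowski_limsup `<=` A ->
  ((C^-1)%:E <= hausdorff_measure dist s A)%E.
Proof.
move=> cptB xB pA; apply: le_ereal_sup_tmp.
exists (hausdorff_premeasure dist s 1 A); first by exists 1 => //=.
apply: le_ereal_inf_tmp => _ [U [AU Udelta] <-].
apply/lee_addgt0Pr => e e0.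
pose gauge_eps n := (gauge dist s (U n) + (e / (2 ^ n.+1)%:R)%:E)%E.
have /choice[V VP] : forall n, exists V, [/\ open V, U n `<=` V &
    \forall k \near \oo, ((level_mass k V)%:E <= C%:E * gauge_eps n)%E].
  by move=> n; apply: level_mass_open_cover (Udelta n) _; rewrite divr_gt0.
have [||N NP] := compact_finite_level_cover cptB xB (V := V).
- by move=> n; have [] := VP n.
- by move=> y /pA /AU[n _ Uy]; exists n => //; have [_ + _] := VP n; apply.
have [k [Nk massV]] : exists k, (N <= k)%N /\ forall n : 'I_N,
    ((level_mass k (V n))%:E <= C%:E * gauge_eps n)%E.
  near \oo => k; exists k; split; first by near: k; exact: nbhs_infty_ge.
  by near: k; apply: filter_forall => n; have [] := VP n.
have gauge_eps_ge0 n : (0 <= gauge_eps n)%E.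
  by rewrite adde_ge0 ?gauge_ge0// lee_fin divr_ge0// ltW.
apply: le_trans (epsilon_trick xpredT (fun n => gauge_ge0 _ _ (U n)) (ltW e0)).
apply: le_trans (nneseries_lim_ge N (fun n _ _ => gauge_eps_ge0 n)).
rewrite -[leLHS]mule1 lee_pdivrMl// big_mkord ge0_sume_distrr//.
apply: le_trans (lee_sum _ (fun n _ => massV n)).
by rewrite sumEFin lee_fin level_mass_bigcup_ge1// => i; exact: NP.
Unshelve. all: by end_near.
Qed.

End MassDistribution.

(** * The Euclidean distance *)

Lemma ball_rVP (R : realType) (d : nat) (p q : 'rV[R]_d) (e : R) :
  ball p e q <-> 0 < e /\ forall i, `|p ord0 i - q ord0 i| < e.
Proof.
split=> -[e0 pq]; split => // i; first exact: (pq ord0 i).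
by move=> j; rewrite ord1; exact: pq.
Qed.

Section EuclideanDistance.
Context {R : realType} {d : nat}.
Implicit Types p q : 'rV[R]_d.

Lemma euclidean_dist_ge0 p q : 0 <= euclidean_dist p q.
Proof. exact: sqrtr_ge0. Qed.

Lemma coord_le_euclidean_dist p q i :
  `|p ord0 i - q ord0 i| <= euclidean_dist p q.
Proof.
rewrite -sqrtr_sqr ler_sqrt; last by apply: sumr_ge0 => j _; exact: sqr_ge0.
by rewrite (bigD1 i)//= lerDl sumr_ge0// => j _; exact: sqr_ge0.
Qed.

Lemma euclidean_dist_lt_ball p q (e : R) : euclidean_dist p q < e -> ball p e q.
Proof.
move=> pq; apply/ball_rVP; split.
  exact: le_lt_trans (euclidean_dist_ge0 p q) pq.
by move=> i; exact: le_lt_trans (coord_le_euclidean_dist p q i) pq.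
Qed.

Lemma euclidean_dist_le p q (e : R) : 0 <= e ->
  (forall i, `|p ord0 i - q ord0 i| <= e) -> euclidean_dist p q <= d%:R * e.
Proof.
move=> e0 pq; rewrite -(ger0_norm (mulr_ge0 (ler0n R d) e0)) -sqrtr_sqr.
rewrite ler_sqrt ?sqr_ge0// (@le_trans _ _ (\sum_(i < d) e ^+ 2))//.
  apply: ler_sum => i _.
  by rewrite -[leLHS]real_normK ?num_real// lerXn2r ?nnegrE.
rewrite sumr_const card_ord -[leLHS]mulr_natl exprMn ler_wpM2r ?sqr_ge0//.
by rewrite -natrX ler_nat -mulnn; case: d => // n; rewrite leq_pmulr.
Qed.

End EuclideanDistance.

(** * Coprime pairs *)

Lemma sum_dvdn_divn (g n : nat) : (0 < g)%N ->
  (\sum_(i < n) (g %| i.+1) = n %/ g)%N.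
Proof.
move=> g0; elim: n => [|n IH]; first by rewrite big_ord0 div0n.
by rewrite big_ord_recr /= IH divnS// addnC.
Qed.

Lemma sum_inv_odd_sqr_le (F : realFieldType) (n : nat) :
  \sum_(h < n) ((2 * h + 3)%:R ^+ 2)^-1 <= 4^-1 :> F.
Proof.
suff : \sum_(h < n) ((2 * h + 3)%:R ^+ 2)^-1 <= 4^-1 - (4 * n.+1%:R)^-1 :> F.
  by move=> /le_trans; apply; rewrite gerBl invr_ge0 mulr_ge0.
elim: n => [|n IH]; first by rewrite big_ord0 mulr1 subrr.
rewrite big_ord_recr /=; apply: (le_trans (lerD IH (lexx _))).
have n0 : 0 <= n%:R :> F by [].
rewrite -lerBrDl natrD natrM -(natr1 n.+1) -(natr1 n).
set x := n%:R in n0 *.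
have -> : 4^-1 - (4 * (x + 1 + 1))^-1 - (4^-1 - (4 * (x + 1))^-1) =
    ((2 * x + 2) * (2 * x + 4))^-1 :> F by field; lra.
rewrite lef_pV2 ?posrE; first nra.
- by apply: exprn_gt0; lra.
- by apply: mulr_gt0; lra.
Qed.

Definition coprime_pairs (X Y : nat) : {set 'I_X * 'I_Y} :=
  [set p : 'I_X * 'I_Y | coprime p.1.+1 p.2.+1]%SET.

Definition dvdn_pairs (X Y g : nat) : {set 'I_X * 'I_Y} :=
  [set p : 'I_X * 'I_Y | (g %| p.1.+1)%N && (g %| p.2.+1)%N]%SET.

Lemma card_dvdn_pairs (X Y g : nat) : (0 < g)%N ->
  #|dvdn_pairs X Y g| = ((X %/ g) * (Y %/ g))%N.
Proof.
move=> g0; rewrite -(sum_dvdn_divn X g0) -(sum_dvdn_divn Y g0).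
rewrite big_distrlr pair_bigA -sum1_card big_mkcond /=.
by apply: eq_bigr => p _; rewrite inE mulnb; case: andP.
Qed.

Lemma card_dvdn_pairs_le (F : realFieldType) (X Y g : nat) : (0 < g)%N ->
  #|dvdn_pairs X Y g|%:R <= (X * Y)%:R * (g%:R ^+ 2)^-1 :> F.
Proof.
move=> g0; rewrite card_dvdn_pairs// !natrM expr2 invfM mulrACA.
have divn_le n : (n %/ g)%:R <= n%:R / g%:R :> F.
  by rewrite ler_pdivlMr ?ltr0n// -natrM ler_nat leq_trunc_div.
exact: ler_pM.
Qed.

Lemma noncoprime_common_divisor (m n : nat) : (0 < m)%N -> ~~ coprime m n ->
  (2 %| m)%N && (2 %| n)%N \/
  exists2 h, (h < m)%N & (2 * h + 3 %| m)%N && (2 * h + 3 %| n)%N.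
Proof.
move=> m0 mn; have gcd_gt1 : (1 < gcdn m n)%N.
  by rewrite ltn_neqAle eq_sym mn gcdn_gt0 m0.
set p := pdiv (gcdn m n); have p_prime : prime p := pdiv_prime gcd_gt1.
have /andP[pm pn] : (p %| m)%N && (p %| n)%N by rewrite -dvdn_gcd pdiv_dvd.
have [p2|p_odd] := even_prime p_prime; first by left; rewrite -p2 pm.
right; exists ((p - 3) %/ 2)%N.
- by have := dvdn_leq m0 pm; move: p_odd (prime_gt1 p_prime); clear; lia.
- rewrite (_ : 2 * _ + 3 = p)%N ?pm//.
  by move: p_odd (prime_gt1 p_prime); clear; lia.
Qed.

Lemma card_noncoprime_pairs_le (X Y : nat) :
  (#|~: coprime_pairs X Y| <=
   #|dvdn_pairs X Y 2| + \sum_(h < X) #|dvdn_pairs X Y (2 * h + 3)|)%N.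
Proof.
rewrite -!sum1_card big_mkcond [X in (_ <= X + _)%N]big_mkcond /=.
under [X in (_ <= _ + X)%N]eq_bigr => h _ do rewrite -sum1_card big_mkcond /=.
rewrite exchange_big -big_split; apply: leq_sum => p _; rewrite !inE.
case: ifPn => // /(noncoprime_common_divisor (ltn0Sn _))[->//|[h hp dvd_h]].
have hX : (h < X)%N by exact: leq_trans hp (ltn_ord p.1).
by rewrite (bigD1 (Ordinal hX))//= inE dvd_h addnCA.
Qed.

(* A common prime factor is 2 or odd, and [1/4 + 1/9 + 1/25 + ... <= 1/2]. *)
Lemma card_coprime_pairs_ge (X Y : nat) : (X * Y <= 2 * #|coprime_pairs X Y|)%N.
Proof.
have : #|~: coprime_pairs X Y|%:R <= (X * Y)%:R / 2 :> rat.
  have := card_noncoprime_pairs_le X Y; rewrite -(ler_nat rat) natrD natr_sum.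
  move=> /le_trans; apply.
  have even_le := card_dvdn_pairs_le rat X Y (ltn0Sn 1).
  have odd_le : \sum_(h < X) #|dvdn_pairs X Y (2 * h + 3)|%:R <=
      (X * Y)%:R / 4 :> rat.
    apply: (@le_trans _ _ ((X * Y)%:R * \sum_(h < X) ((2 * h + 3)%:R ^+ 2)^-1)).
      by rewrite mulr_sumr ler_sum// => h _; rewrite card_dvdn_pairs_le// addnS.
    by rewrite ler_wpM2l// sum_inv_odd_sqr_le.
  by lra.
have := cardsC (coprime_pairs X Y); rewrite card_prod !card_ord.
by rewrite ler_pdivlMr// -natrM ler_nat; lia.
Qed.

Lemma card_coprime_pairs_top_ge (X Y : nat) :
  (X * Y <= #|[set p in coprime_pairs (4 * X) Y | (X <= p.1)%N]%SET|)%N.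
Proof.
pose low := [set p : 'I_(4 * X) * 'I_Y | (p.1 < X)%N]%SET.
have card_low : (#|low| <= X * Y)%N.
  have -> : low =
      finset.setX [set i : 'I_(4 * X) | (i < X)%N]%SET [set: 'I_Y]%SET.
    by apply/setP => p; rewrite !inE andbT.
  rewrite cardsX cardsT card_ord leq_mul2r; apply/orP; right.
  rewrite cardE -(size_map val) -[leqRHS](size_iota 0).
  apply: uniq_leq_size; first by rewrite (map_inj_uniq val_inj) enum_uniq.
  by move=> _ /mapP[i + ->]; rewrite mem_enum inE mem_iota.
have -> : [set p in coprime_pairs (4 * X) Y | (X <= p.1)%N]%SET =
    (coprime_pairs (4 * X) Y :\: low)%SET.
  by apply/setP => p; rewrite !inE -leqNgt andbC.
have := card_coprime_pairs_ge (4 * X) Y; rewrite -(cardsID low).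
have := subset_leq_card (subsetIr (coprime_pairs (4 * X) Y) low).
move=> /leq_trans/(_ card_low).
by move: #|_ :&: _| #|_ :\: _| => a b; lia.
Qed.

Lemma coprime_cross_dvd (x y x' y' : nat) :
  coprime x y -> (x * y' = x' * y)%N -> (x %| x')%N && (y %| y')%N.
Proof.
move=> xy cross; rewrite -(Gauss_dvdl x' xy) -cross dvdn_mulr//=.
by rewrite coprime_sym in xy; rewrite -(Gauss_dvdr y' xy) cross dvdn_mull.
Qed.

Lemma coprime_cross_inj (x y x' y' : nat) : coprime x y -> coprime x' y' ->
  (x * y' = x' * y)%N -> x = x' /\ y = y'.
Proof.
move=> xy x'y' cross.
have /andP[xx' yy'] := coprime_cross_dvd xy cross.
have /andP[x'x y'y] := coprime_cross_dvd x'y' (esym cross).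
by split; apply/eqP; rewrite eqn_dvd; apply/andP.
Qed.

(** * Rationals to the right of a given rational *)

Lemma denq_div_le (p : int) (q : nat) : (0 < q)%N ->
  denq (p%:~R / q%:R) <= q%:Z.
Proof.
move=> q0; rewrite (_ : q%:R = q%:Z%:~R) ?pmulrn//.
have : 0 < q%:Z by []; case: divqP => // k x k0.
rewrite pmulr_lgt0 ?denq_gt0// => kp.
by rewrite ler_peMl ?denq_ge0// -gtz0_ge1.
Qed.

Lemma denq_bezout (r : rat) : exists (a : int) (b : nat),
  a * denq r - numq r * b = 1 /\ b%:Z < denq r.
Proof.
have [u [v]] := Bezoutz (numq r) (denq r).
have -> : gcdz (numq r) (denq r) = 1 by rewrite /gcdz (eqP (coprime_num_den r)).
move=> bezout; pose k := divz (- u) (denq r).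
have modE : modz (- u) (denq r) = - u - k * denq r.
  by rewrite [X in X - _](divz_eq _ (denq r)) addrC addKr.
have mod_ge0 : 0 <= modz (- u) (denq r) by rewrite modz_ge0// denq_neq0.
exists (v - k * numq r), `|modz (- u) (denq r)|%N; rewrite gez0_abs//; split.
- by rewrite modE -bezout; ring.
- by rewrite ltz_pmod// denq_gt0.
Qed.

Definition mediant (a a' : int) (b b' x y : nat) : rat :=
  (a * x + a' * y)%:~R / (b * x + b' * y)%:R.

Section Mediant.
Context (a a' : int) (b b' : nat).
Hypotheses (b_gt0 : (0 < b)%N) (det1 : a' * b - a * b' = 1).

Lemma mediant_sub (x y : nat) : (0 < x)%N ->
  mediant a a' b b' x y - a%:~R / b%:R = y%:R / (b * (b * x + b' * y))%:R.
Proof.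
move=> x0; have den_neq0 : b%:R * x%:R + b'%:R * y%:R != 0 :> rat.
  by rewrite -!natrM -natrD pnatr_eq0 -lt0n addn_gt0 muln_gt0 b_gt0 x0.
have b_neq0 : b%:R != 0 :> rat by rewrite pnatr_eq0 -lt0n.
have -> : y%:R = y%:R * (a' * b%:Z - a * b'%:Z)%:~R :> rat.
  by rewrite det1 mulr1.
rewrite /mediant !(natrD, natrM, rmorphD, rmorphB, rmorphM) /= -!pmulrn.
by field; rewrite b_neq0 den_neq0.
Qed.

Lemma mediant_inj (x y x' y' : nat) : (0 < x)%N -> (0 < x')%N ->
  coprime x y -> coprime x' y' ->
  mediant a a' b b' x y = mediant a a' b b' x' y' -> x = x' /\ y = y'.
Proof.
move=> x0 x'0 xy x'y' /(congr1 (fun z => z - a%:~R / b%:R)).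
rewrite !mediant_sub// => /eqP; rewrite eqr_div ?pnatr_eq0; last 2 first.
- by rewrite -lt0n !(muln_gt0, addn_gt0) b_gt0 x0.
- by rewrite -lt0n !(muln_gt0, addn_gt0) b_gt0 x'0.
rewrite -!natrM eqr_nat => /eqP cross; apply: coprime_cross_inj => //.
by apply/eqP; rewrite -(eqn_pmul2l b_gt0) -(eqn_pmul2l b_gt0); apply/eqP; lia.
Qed.

End Mediant.

Lemma close_fractions (r : rat) (X Y : nat) : (Y <= X)%N ->
  exists s : seq rat, [/\ uniq s, (X * Y <= size s)%N &
    forall r', r' \in s ->
      [/\ r < r', r' - r <= Y%:R / ((denq r)%:~R ^+ 2 * X%:R) &
        denq r' <= 5 * denq r * X]].
Proof.
move=> YX; have [a' [b' []]] := denq_bezout r.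
have [b denE] : exists b : nat, denq r = b%:Z.
  by exists `|denq r|%N; rewrite gez0_abs ?denq_ge0.
have b0 : (0 < b)%N by rewrite -ltz_nat -denE denq_gt0.
rewrite denE ltz_nat => det1 b'b.
have rE : r = (numq r)%:~R / b%:R by rewrite -[LHS]divq_num_den denE.
pose P := [set p in coprime_pairs (4 * X) Y | (X <= p.1)%N]%SET.
pose f (p : 'I_(4 * X) * 'I_Y) := mediant (numq r) a' b b' p.1.+1 p.2.+1.
exists (map f (enum P)); split.
- rewrite map_inj_in_uniq ?enum_uniq// => -[x y] [x' y'].
  rewrite !mem_enum !inE /= => /andP[xy _] /andP[x'y' _].
  move=> /(mediant_inj b0 det1 (ltn0Sn x) (ltn0Sn x') xy x'y')[[xx'] [yy']].
  by congr pair; apply: val_inj.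
- by rewrite size_map -cardE card_coprime_pairs_top_ge.
move=> _ /mapP[[x y] + ->]; rewrite mem_enum !inE /= => /andP[_ Xx].
have den_gt0 : (0 < b * x.+1 + b' * y.+1)%N by rewrite addn_gt0 muln_gt0 b0.
have fr : f (x, y) - r = y.+1%:R / (b * (b * x.+1 + b' * y.+1))%:R.
  by rewrite [X in _ - X]rE mediant_sub.
split.
- by rewrite -subr_gt0 fr divr_gt0// ltr0n muln_gt0 b0.
- rewrite fr; apply: ler_pM; rewrite ?invr_ge0// ?ler_nat//.
  have X0 : (0 < X)%N by apply: leq_trans YX; exact: leq_ltn_trans (ltn_ord y).
  rewrite -pmulrn -natrX -natrM lef_pV2 ?posrE ?ltr0n ?ler_nat.
  + rewrite -mulnn -mulnA leq_mul// (leq_trans _ (leq_addr _ _))//.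
    by rewrite leq_mul// leqW.
  + by rewrite muln_gt0 b0.
  + by rewrite muln_gt0 expn_gt0 b0 X0.
- apply: le_trans (denq_div_le _ den_gt0) _; rewrite -!PoszM lez_nat.
  have := ltn_ord x; have := ltn_ord y; nia.
Qed.

Lemma rat_dist_denq_ge1 (r r' : rat) :
  r != r' -> 1 <= `|r - r'| * (denq r * denq r')%:~R.
Proof.
move=> rr'; set D := (denq r * denq r')%:~R.
have D0 : 0 < D :> rat by rewrite ltr0z mulr_gt0 ?denq_gt0.
have numE : (r - r') * D = (numq r * denq r' - numq r' * denq r)%:~R.
  by rewrite rmorphB !rmorphM /= !numqE /D rmorphM /=; ring.
have : (r - r') * D != 0 by rewrite mulf_neq0 ?subr_eq0// gt_eqF.
rewrite -{2}(gtr0_norm D0) -normrM numE intr_eq0 -intr_norm ler1z => num_neq0.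
by rewrite -gtz0_ge1 normr_gt0.
Qed.

Lemma rat_separation (F : numFieldType) (r r' : rat) (Q Q' : nat) :
  r != r' -> denq r <= Q%:Z -> denq r' <= Q'%:Z ->
  1 <= `|ratr r - ratr r'| * (Q%:R * Q'%:R) :> F.
Proof.
move=> rr' rQ r'Q'; have : 1 <= `|r - r'| * (Q%:R * Q'%:R).
  apply: le_trans (rat_dist_denq_ge1 rr') _; rewrite ler_wpM2l// intrM.
  by rewrite !pmulrn ler_pM ?ler0z ?denq_ge0// ler_int.
by rewrite -(ler_rat F) rmorph1 !rmorphM /= !ratr_nat ratr_norm rmorphB.
Qed.

(** * Growth of the scales *)

Section RealPowers.
Context {R : realType}.

Lemma ler_powRN (a b t : R) : 0 < a -> a <= b -> 0 <= t ->
  b `^ (- t) <= a `^ (- t).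
Proof.
move=> a0 ab t0; have b0 : 0 < b := lt_le_trans a0 ab.
rewrite !powRN lef_pV2 ?posrE ?powR_gt0//.
by rewrite ge0_ler_powR ?nnegrE ?(ltW a0) ?(ltW b0).
Qed.

Lemma near_infty_le_powR (a M : R) : 0 < a ->
  \forall n \near \oo, M <= n%:R `^ a.
Proof.
move=> a0; near=> n; apply: (@le_trans _ _ `|M|); first exact: ler_norm.
have -> : `|M| = (`|M| `^ a^-1) `^ a by rewrite -powRrM mulVf ?gt_eqF// powRr1.
rewrite ge0_ler_powR ?nnegrE ?powR_ge0 ?(ltW a0)//.
by near: n; exact: nbhs_infty_ger.
Unshelve. all: by end_near.
Qed.

Lemma near_infty_powRN_le (a b c e : R) : a < b -> 0 < e ->
  \forall n \near \oo, c * n%:R `^ (- b) <= e * n%:R `^ (- a).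
Proof.
move=> ab e0; near=> n.
have n0 : (0 < n%:R :> R) by rewrite ltr0n; near: n; exact: nbhs_infty_gt.
rewrite [X in c * X]powRN ler_pdivrMr ?powR_gt0// -mulrA -powRD; last first.
  by rewrite (lt0r_neq0 n0) implybT.
rewrite -ler_pdivrMl// addrC mulrC; near: n.
by apply: near_infty_le_powR; rewrite subr_gt0.
Unshelve. all: by end_near.
Qed.

Lemma half_le_truncn (x : R) : 1 <= x -> x / 2 <= (Num.trunc x)%:R.
Proof.
move=> x1; have : x < (Num.trunc x).+1%:R by exact: truncnS_gt.
have : 1 <= (Num.trunc x)%:R :> R by rewrite ler1n truncn_gt0.
by rewrite -natr1; lra.
Qed.

End RealPowers.

Lemma quotient_bounds (a q : nat) : (0 < a <= q)%N ->
  exists2 X, (a * X <= q)%N & (q <= 2 * (a * X))%N.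
Proof.
move=> /andP[a0 aq]; exists (q %/ a)%N; first by rewrite mulnC leq_trunc_div.
have : (0 < q %/ a)%N by rewrite divn_gt0.
by have := ltn_ceil q a0; rewrite mulSn mulnC; nia.
Qed.

Lemma fraction_ranges_exist (R : realType) (b q : nat) (rho : R) :
  (0 < b)%N -> rho * b%:R ^+ 2 <= 1 -> 40 <= rho * q%:R ->
  exists X Y : nat, [/\ (Y <= X)%N, (5 * b * X <= q)%N,
    Y%:R / (b%:R ^+ 2 * X%:R) <= rho / 4 & rho * q%:R ^+ 2 / 800 <= (X * Y)%:R].
Proof.
move=> b_gt0 rho_b rho_q; have b1 : 1 <= b%:R :> R by rewrite ler1n.
have rho0 : 0 < rho.
  by rewrite ltNge; apply/negP => rho0; have := ler0n R q; nra.
have q_b : 40 * b%:R <= q%:R :> R.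
  have : rho * (40 * b%:R) <= rho * q%:R by nra.
  by rewrite ler_pM2l.
have [|X X_le X_ge] := @quotient_bounds (5 * b) q.
  by rewrite muln_gt0 b_gt0 /= -(ler_nat R) natrM; lra.
have {}X_ge : q%:R <= 10 * b%:R * X%:R :> R by rewrite -!natrM ler_nat; lia.
have b0 : 0 < b%:R :> R by lra.
have X0 : 0 < X%:R :> R.
  by rewrite ltNge; apply/negP => X0; nra.
pose w := rho / 4 * b%:R ^+ 2 * X%:R.
have w1 : 1 <= w.
  have : rho * q%:R <= rho * (10 * b%:R * X%:R) by rewrite ler_pM2l.
  have : rho * X%:R * b%:R <= rho * X%:R * b%:R ^+ 2.
    by rewrite ler_pM2l ?mulr_gt0// expr2; nra.
  by rewrite /w; lra.
have w_X : w <= X%:R.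
  have : rho * b%:R ^+ 2 * X%:R <= 1 * X%:R by rewrite ler_pM2r.
  by rewrite /w; lra.
have Y_le : (Num.trunc w)%:R <= w by rewrite truncn_le; lra.
exists X, (Num.trunc w); split => //.
- by rewrite -(ler_nat R) (le_trans Y_le).
- rewrite ler_pdivrMr ?mulr_gt0 ?exprn_gt0//.
  by apply: (le_trans Y_le); rewrite /w; lra.
- have : X%:R * (w / 2) <= X%:R * (Num.trunc w)%:R.
    by rewrite ler_pM2l// half_le_truncn.
  have : rho * q%:R ^+ 2 <= rho * (10 * b%:R * X%:R) ^+ 2.
    by rewrite ler_pM2l// lerXn2r ?nnegrE ?ler0n// !mulr_ge0.
  by rewrite natrM /w; lra.
Qed.

Definition close_children {R : realType} (rho : R) (r : rat) (q n : nat)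
    (g : 'I_n -> rat) : Prop :=
  injective g /\
  forall j, [/\ r < g j, ratr (g j) - ratr r <= rho / 4 & denq (g j) <= q%:Z].

Lemma close_children_exist (R : realType) (r : rat) (q q' n : nat) (rho : R) :
  denq r <= q%:Z -> rho * q%:R ^+ 2 <= 1 -> 40 <= rho * q'%:R ->
  n%:R <= rho * q'%:R ^+ 2 / 800 ->
  exists g : 'I_n -> rat, close_children rho r q' g.
Proof.
move=> rq rho_q rho_q' n_le; pose b := `|denq r|%N.
have denE : denq r = b%:Z by rewrite /b gez0_abs ?denq_ge0.
have b0 : (0 < b)%N by rewrite -ltz_nat -denE denq_gt0.
have rho0 : 0 < rho.
  by rewrite ltNge; apply/negP => rho0; have := ler0n R q'; nra.
have rho_b : rho * b%:R ^+ 2 <= 1.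
  apply: le_trans rho_q; rewrite ler_pM2l// lerXn2r ?nnegrE// ler_nat.
  by rewrite -lez_nat -denE.
have [X [Y [YX bXq' close card_ge]]] := fraction_ranges_exist b0 rho_b rho_q'.
have [s [uniq_s size_s sP]] := close_fractions r YX.
have n_size : (n <= size s)%N.
  by apply: leq_trans size_s; rewrite -(ler_nat R) (le_trans n_le).
have lt_size (j : 'I_n) : (j < size s)%N by exact: leq_trans (ltn_ord j) n_size.
exists (fun j => nth 0 s j); split=> [i j /eqP|j].
  by rewrite nth_uniq// => /eqP /val_inj.
have [lt_r close_r den_r] := sP _ (mem_nth 0 (lt_size j)); split => //.
- apply: le_trans close; move: close_r.
  by rewrite -(ler_rat R) rmorphB fmorph_div denE !rmorphM /= !ratr_nat.
- by apply: le_trans den_r _; rewrite denE -!PoszM lez_nat.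
Qed.

Definition radius {R : realType} (tau : R) (q : nat) : R := q%:R `^ (- tau).

(* The constant 800 is what the rounding in [fraction_ranges_exist] costs. *)
Definition branching {R : realType} (tau : R) (q q' : nat) : nat :=
  Num.trunc (radius tau q * q'%:R ^+ 2 / 800).

Section Radius.
Context {R : realType} (tau : R).
Implicit Types q : nat.

Lemma radius_gt0 q : (0 < q)%N -> 0 < radius tau q.
Proof. by move=> q0; rewrite powR_gt0// ltr0n. Qed.

Lemma radius1 : radius tau 1 = 1.
Proof. by rewrite /radius powR1. Qed.

Lemma radius_le q q' : 0 <= tau -> (0 < q)%N -> (q <= q')%N ->
  radius tau q' <= radius tau q.
Proof. by move=> tau0 q0 qq'; apply: ler_powRN; rewrite ?ltr0n ?ler_nat. Qed.

Lemma radius_double_le q q' : 1 <= tau -> (0 < q)%N -> (2 * q <= q')%N ->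
  radius tau q' <= radius tau q / 2.
Proof.
move=> tau1 q0 qq'; apply: (@le_trans _ _ (radius tau (2 * q))).
  by rewrite radius_le ?muln_gt0// (le_trans ler01).
rewrite /radius natrM powRM// mulrC ler_wpM2l ?powR_ge0//.
by rewrite powRN lef_pV2 ?posrE ?powR_gt0// le1r_powR// ler1n.
Qed.

Lemma radius_sqr_le1 q : 2 <= tau -> (0 < q)%N -> radius tau q * q%:R ^+ 2 <= 1.
Proof.
move=> tau2 q0.
rewrite /radius powRN mulrC ler_pdivrMr ?powR_gt0 ?ltr0n// mul1r.
by rewrite -powR_mulrn// ler_powR// ler1n.
Qed.

End Radius.

Section Scales.
Context {R : realType} (tau u : R).
Implicit Types q : nat.

Lemma branching_ge q q' : 800 <= radius tau q * q'%:R ->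
  radius tau q * q'%:R ^+ 2 <= 1600 * (branching tau q q')%:R.
Proof.
move=> large; have q'_ge1 : 1 <= q'%:R :> R.
  rewrite ler1n lt0n; apply: contraTneq large => ->.
  by rewrite mulr0 -ltNge ltr0n.
have large_sqr : 800 <= radius tau q * q'%:R ^+ 2.
  by rewrite expr2 mulrA (le_trans large)// ler_peMr ?q'_ge1//; lra.
have : radius tau q * q'%:R ^+ 2 / 800 / 2 <= (branching tau q q')%:R.
  by apply: half_le_truncn; lra.
by lra.
Qed.

Definition next_scale q q' : Prop :=
  [/\ (2 * q <= q')%N, 800 <= radius tau q * q'%:R &
    1 <= (branching tau q q')%:R * radius tau q' `^ u].

Lemma near_infty_next_scale q : tau * u < 2 -> (0 < q)%N ->
  \forall q' \near \oo, next_scale q q'.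
Proof.
move=> tau_u q0; have rho0 := radius_gt0 tau q0; near=> q'.
have q'0 : 0 < q'%:R :> R by rewrite ltr0n; near: q'; exact: nbhs_infty_gt.
have large : 800 <= radius tau q * q'%:R.
  rewrite -ler_pdivrMl//; near: q'; exact: nbhs_infty_ger.
split => //; first by near: q'; exact: nbhs_infty_ge.
have : radius tau q * q'%:R ^+ 2 * radius tau q' `^ u <=
    1600 * (branching tau q q')%:R * radius tau q' `^ u.
  by rewrite ler_wpM2r ?powR_ge0// branching_ge.
have -> : radius tau q * q'%:R ^+ 2 * radius tau q' `^ u =
    radius tau q * q'%:R `^ (2 - tau * u).
  rewrite /radius -(powRrM q'%:R) -(powR_mulrn 2)// mulNr -mulrA -powRD//.
  by rewrite (lt0r_neq0 q'0) implybT.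
have : 1600 <= radius tau q * q'%:R `^ (2 - tau * u).
  rewrite -ler_pdivrMl//; near: q'; apply: near_infty_le_powR; lra.
by lra.
Unshelve. all: by end_near.
Qed.

Lemma scales_exist : tau * u < 2 ->
  exists2 Q : nat -> nat, Q 0%N = 1%N & forall k, next_scale (Q k) (Q k.+1).
Proof.
move=> tau_u; have /choice[next nextP] : forall q, exists q',
    (0 < q)%N -> next_scale q q'.
  case=> [|q]; first by exists 0%N.
  have [N _ NP] := near_infty_next_scale tau_u (ltn0Sn q).
  by exists N => _; exact: NP N (leqnn N).
exists (fun k => iter k next 1%N) => // k; apply: (nextP).
elim: k => //= k IH; have [+ _ _] := nextP _ IH; apply: leq_trans.
by rewrite muln_gt0.
Qed.

End Scales.

(** * Counting points of Cantor trees *)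

(* Nodes of level [k] of the tree in which each node of level [j] has [m j]
   children; the parent of [w] is [w.1]. *)
Fixpoint address (m : nat -> nat) (k : nat) : finType :=
  if k is k'.+1 then (address m k' * 'I_(m k'))%type else unit.

Lemma card_addressS (m : nat -> nat) k :
  #|address m k.+1| = (#|address m k| * m k)%N.
Proof. by rewrite card_prod card_ord. Qed.

Lemma truncn_eq_dist_lt1 (R : archiRealDomainType) (a b : R) :
  0 <= a -> 0 <= b -> Num.trunc a = Num.trunc b -> `|a - b| < 1.
Proof.
move=> /truncn_itv/andP[a_ge a_lt] /truncn_itv/andP[b_ge b_lt] ab.
by move: a_ge a_lt; rewrite ab -natr1 in b_lt *; rewrite ltr_norml; lra.
Qed.

Lemma card_separated_le (R : realType) (I : finType) (x : I -> R)
    (delta c e : R) :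
  0 < delta -> 0 <= e -> (forall i j, i != j -> delta <= `|x i - x j|) ->
  #|[set i | `|x i - c| <= e]%SET|%:R <= 2 * e / delta + 1.
Proof.
move=> delta0 e0 sep; set S := [set i | _]%SET.
pose pos i := (x i - c + e) / delta; pose n := Num.trunc (2 * e / delta).
have posP i : i \in S -> 0 <= pos i <= 2 * e / delta.
  rewrite inE ler_norml => /andP[lo hi].
  by rewrite divr_ge0 ?(ltW delta0) ?ler_pM2r ?invr_gt0//; lra.
have cell_lt i : i \in S -> (Num.trunc (pos i) < n.+1)%N.
  by move=> /posP/andP[_ hi]; rewrite ltnS le_truncn.
have cell_inj :
    {in S &, injective (fun i => inord (Num.trunc (pos i)) : 'I_n.+1)}.
  move=> i j iS jS /(congr1 val) /=; rewrite !inordK ?cell_lt// => ij.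
  apply/eqP; apply: contraT => /sep; rewrite leNgt => /negP; case.
  have /andP[pi0 _] := posP i iS; have /andP[pj0 _] := posP j jS.
  have := truncn_eq_dist_lt1 pi0 pj0 ij.
  have -> : pos i - pos j = (x i - x j) / delta.
    by rewrite -mulrBl; congr (_ / _); ring.
  by rewrite normf_div (gtr0_norm delta0) ltr_pdivrMr// mul1r.
have := leq_card_in _ _ cell_inj; rewrite card_ord -(ler_nat R).
move=> /le_trans; apply.
by rewrite -natr1 lerD2r truncn_le divr_ge0// ?mulr_ge0// ltW.
Qed.

Lemma powR_interpolation_le (R : realType) (N e rho u : R) :
  0 < e <= rho -> u <= 1 -> 1 <= N * rho `^ u -> e <= e `^ u * (N * rho).
Proof.
move=> /andP[e0 e_rho] u1 mass; have rho0 : 0 < rho := lt_le_trans e0 e_rho.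
have split_powR (z : R) : 0 < z -> z = z `^ u * z `^ (1 - u).
  move=> z0; rewrite -powRD; last by rewrite lt0r_neq0 ?implybT.
  by rewrite addrC subrK powRr1// ltW.
rewrite {1}(split_powR e e0) ler_wpM2l ?powR_ge0//.
apply: (@le_trans _ _ (rho `^ (1 - u))).
  by rewrite ge0_ler_powR ?nnegrE ?(ltW e0) ?(ltW rho0)//; lra.
by rewrite {2}(split_powR rho rho0) mulrA ler_peMl ?powR_ge0.
Qed.

Section CantorTree.
Context {R : realType} (m : nat -> nat) (x : forall k, address m k -> R).
Context (rho : nat -> R).
Hypothesis rho_half : forall k, rho k.+1 <= rho k / 2.
Hypothesis child_close : forall k (w : address m k.+1),
  `|x w - x w.1| <= rho k / 4.

Local Notation N k := #|address m k|.

Definition near_count k (c e : R) : nat :=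
  #|[set w : address m k | `|x w - c| <= e]%SET|.

Lemma tree_ancestor k l (w : address m l) : (k <= l)%N ->
  exists v : address m k, `|x w - x v| <= (rho k - rho l) / 2.
Proof.
elim: l w => [|l IH] w.
  by rewrite leqn0 => /eqP ->; exists w; rewrite !subrr normr0 mul0r.
rewrite leq_eqVlt => /predU1P[->|kl].
  by exists w; rewrite !subrr normr0 mul0r.
have [v wv] := IH w.1 kl; exists v.
have := ler_normD (x w - x w.1) (x w.1 - x v); rewrite subrKA.
by have := child_close w; have := rho_half l; lra.
Qed.

Lemma near_count_le k (c e e' : R) : e <= e' ->
  (near_count k c e <= near_count k c e')%N.
Proof.
move=> ee'; apply: subset_leq_card; apply/fintype.subsetP => w.
by rewrite !inE => /le_trans; apply.
Qed.

Lemma near_count_child k (c e : R) :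
  (near_count k.+1 c e <= near_count k c (e + rho k / 4) * m k)%N.
Proof.
rewrite -[m k in leqRHS]card_ord -cardsT -cardsX.
apply: subset_leq_card; apply/fintype.subsetP => w; rewrite !inE andbT => wc.
rewrite -(subrKA (x w)) (le_trans (ler_normD _ _))// addrC lerD// distrC.
exact: child_close.
Qed.

Lemma near_count_descendants j n (c e : R) :
  (near_count (n + j) c e * N j <=
   N (n + j) * near_count j c (e + (rho j - rho (n + j)) / 2))%N.
Proof.
elim: n e => [|n IH] e; first by rewrite subrr mul0r addr0 mulnC.
rewrite addSn card_addressS; set k := (n + j)%N in IH *.
apply: leq_trans (leq_mul (near_count_child k c e) (leqnn _)) _.
rewrite mulnAC (mulnAC (N k)) leq_mul2r; apply/orP; right.
apply: leq_trans (IH _) _; rewrite leq_mul2l near_count_le ?orbT//.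
by have := rho_half k; lra.
Qed.

Context (delta : nat -> R) (u C : R).
Hypotheses (rho0 : rho 0%N = 1) (rho_gt0 : forall k, 0 < rho k).
Hypotheses (u_gt0 : 0 < u) (u_le1 : u <= 1).
Hypothesis delta_gt0 : forall k, 0 < delta k.
Hypothesis separated : forall k (v w : address m k),
  v != w -> delta k <= `|x v - x w|.
Hypothesis mass_ge1 : forall k, 1 <= (N k)%:R * rho k `^ u.
Hypothesis growth : forall k,
  (N k)%:R * rho k <= C * (delta k.+1 * (N k.+1)%:R).

Lemma card_address_gt0 k : 0 < (N k)%:R :> R.
Proof.
rewrite ltr0n lt0n; apply/eqP => N0; have := mass_ge1 k.
by rewrite N0 mul0r; lra.
Qed.

Lemma coarsest_scale_le k (e : R) : rho k <= e < 1 ->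
  exists j, [/\ (j < k)%N, rho j.+1 <= e & e < rho j].
Proof.
move=> /andP[ke e1]; have ex : exists j, rho j <= e by exists k.
case: (ex_minnP ex) => -[|j] je jmin.
  by move: je; rewrite rho0; lra.
exists j; split; [exact: jmin|by []|].
by rewrite ltNge; apply/negP => /jmin; rewrite ltnn.
Qed.

Lemma growth_constant_gt0 : 0 < C.
Proof.
have := lt_le_trans (mulr_gt0 (card_address_gt0 0) (rho_gt0 0)) (growth 0).
by rewrite pmulr_lgt0 ?mulr_gt0 ?card_address_gt0.
Qed.

Lemma near_count_separated_le k (c e : R) : 0 <= e ->
  (near_count k c e)%:R <= 2 * e / delta k + 1.
Proof. by move=> e0; apply: card_separated_le => //; exact: separated. Qed.

Lemma near_count_refine_le j k (c e : R) : (j <= k)%N -> rho j <= e ->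
  (near_count k c e)%:R * (N j)%:R <= (N k)%:R * (3 * e / delta j + 1) :> R.
Proof.
move=> jk je; have e0 : 0 < e := lt_le_trans (rho_gt0 j) je.
have := near_count_descendants j (k - j) c e; rewrite subnK// => descend.
have enlarge : (near_count j c (e + (rho j - rho k) / 2) <=
    near_count j c (3 / 2 * e))%N.
  by apply: near_count_le; have := rho_gt0 k; lra.
apply: (@le_trans _ _ (N k * near_count j c (3 / 2 * e))%:R).
  by rewrite -natrM ler_nat (leq_trans descend)// leq_mul2l enlarge orbT.
rewrite natrM ler_wpM2l//; have -> : 3 * e = 2 * (3 / 2 * e) by field.
by apply: near_count_separated_le; lra.
Qed.

Lemma near_count_le_mass k (c e : R) : 1 <= e ->
  (near_count k c e)%:R <= (N k)%:R * e `^ u.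
Proof.
move=> e1; apply: (@le_trans _ _ (N k)%:R); first by rewrite ler_nat max_card.
by rewrite ler_peMr// -(powRr0 e) ler_powR// ltW.
Qed.

Lemma near_count_le_powR k (c e : R) : rho k <= e ->
  (near_count k c e)%:R <= (3 * C + 1) * ((N k)%:R * e `^ u).
Proof.
move=> ke; have e0 : 0 < e := lt_le_trans (rho_gt0 k) ke.
have C0 := growth_constant_gt0.
have [e1|e1] := leP 1 e.
  apply: (le_trans (near_count_le_mass k c e1)).
  by rewrite ler_peMl ?mulr_ge0 ?powR_ge0//; lra.
have [|j [jk j_le j_gt]] := @coarsest_scale_le k e; first by rewrite ke.
have Nj_mass : 1 <= (N j.+1)%:R * e `^ u.
  apply: (le_trans (mass_ge1 j.+1)); rewrite ler_wpM2l//.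
  by rewrite ge0_ler_powR ?nnegrE ?(ltW u_gt0) ?(ltW e0) ?(ltW (rho_gt0 _)).
have e_le : e / delta j.+1 <= C * ((N j.+1)%:R * e `^ u).
  rewrite ler_pdivrMr//; apply: (@le_trans _ _ (e `^ u * ((N j)%:R * rho j))).
    by apply: powR_interpolation_le; rewrite ?e0 ?(ltW j_gt).
  have -> : C * ((N j.+1)%:R * e `^ u) * delta j.+1 =
      e `^ u * (C * (delta j.+1 * (N j.+1)%:R)) by ring.
  by rewrite ler_wpM2l ?powR_ge0.
rewrite -(ler_pM2r (card_address_gt0 j.+1)).
apply: (le_trans (near_count_refine_le c jk j_le)).
have -> : (3 * C + 1) * ((N k)%:R * e `^ u) * (N j.+1)%:R =
    (N k)%:R * ((3 * C + 1) * ((N j.+1)%:R * e `^ u)) by ring.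
rewrite ler_wpM2l//; move: Nj_mass e_le.
by set t := e / _; set z := _ * e `^ u; rewrite -mulrA -/t; lra.
Qed.

End CantorTree.

(** * The lower bound *)

Lemma denominators_gt0 (d : nat) (r : 'rV[rat]_d) (i : 'I_d) :
  (0 < denominators r i)%N.
Proof. by rewrite absz_gt0 denq_neq0. Qed.

Lemma infinite_set_unbounded (T : choiceType) (A : set T) (f : T -> nat) :
  (forall n, exists2 a, A a & (n < f a)%N) -> infinite_set A.
Proof.
move=> unbounded /finite_seqP[s As].
have [a] := unbounded (\max_(a <- s) f a)%N.
by rewrite As ltnNge => /= a_s; rewrite leq_bigmax_seq.
Qed.

Record rational_tree (R : realType) (tau : R) (Q m : nat -> nat)
    (y : forall k, address m k -> rat) : Prop := RationalTree {
  tree_denq_le : forall k (w : address m k), denq (y k w) <= (Q k)%:Z;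
  tree_child_gt : forall k (w : address m k.+1), y k w.1 < y k.+1 w;
  tree_child_close : forall k (w : address m k.+1),
    ratr (y k.+1 w) - ratr (y k w.1) <= radius tau (Q k) / 4;
  tree_inj : forall k, injective (y k) }.

Fixpoint tree_node (m : nat -> nat) (child : forall k, rat -> 'I_(m k) -> rat)
    (k : nat) : address m k -> rat :=
  match k return address m k -> rat with
  | 0 => fun=> 0
  | k'.+1 => fun w => child k' (tree_node child w.1) w.2
  end.

Lemma rational_tree_node (R : realType) (tau : R) (Q m : nat -> nat)
    (child : forall k, rat -> 'I_(m k) -> rat) :
  2 <= tau -> (forall k, 0 < Q k)%N ->
  (forall k r, denq r <= (Q k)%:Z ->
    close_children (radius tau (Q k)) r (Q k.+1) (child k r)) ->
  rational_tree tau Q (@tree_node m child).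
Proof.
move=> tau2 Q_gt0 childP; pose y := @tree_node m child.
have y_denq k (w : address m k) : denq (y k w) <= (Q k)%:Z.
  elim: k w => [|k IH] w /=; first by rewrite lez_nat.
  by have [_ /(_ w.2)[]] := childP k (y k w.1) (IH w.1).
have nodeP k v := childP k (y k v) (y_denq k v).
have y_gt k (w : address m k.+1) : y k w.1 < y k.+1 w.
  by have [_ /(_ w.2)[]] := nodeP k w.1.
have y_close k (w : address m k.+1) :
    ratr (y k.+1 w) - ratr (y k w.1) <= radius tau (Q k) / 4.
  by have [_ /(_ w.2)[]] := nodeP k w.1.
split => //; elim=> [[] []//|k IH v w]; rewrite -!/(y _ _) => vw.
have [vw1|v1w1] := eqVneq v.1 w.1.
  case: v w vw1 vw {IH} => [v i] [w j] /= <- ij; congr pair.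
  by have [inj_g _] := nodeP k v; exact: inj_g.
have y1_neq := contra_neq (IH v.1 w.1) v1w1.
have := rat_separation R y1_neq (y_denq _ v.1) (y_denq _ w.1).
rewrite leNgt => /negP[].
have : `|ratr (y k v.1) - ratr (y k w.1)| <= radius tau (Q k) / 4.
  have := y_gt _ v; have := y_gt _ w; rewrite -!(ltr_rat R) => gt_w gt_v.
  have := y_close _ v; have := y_close _ w; rewrite -vw in gt_w * => w_le v_le.
  by rewrite ler_norml; lra.
have := radius_sqr_le1 tau2 (Q_gt0 k); rewrite -expr2.
have : 0 < (Q k)%:R ^+ 2 :> R by rewrite exprn_gt0// ltr0n.
by set q := _ ^+ 2; nra.
Qed.

Lemma rational_tree_exists (R : realType) (tau : R) (Q : nat -> nat) :
  2 <= tau -> (forall k, 0 < Q k)%N ->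
  (forall k, 800 <= radius tau (Q k) * (Q k.+1)%:R) ->
  exists y, @rational_tree R tau Q (fun k => branching tau (Q k) (Q k.+1)) y.
Proof.
move=> tau2 Q_gt0 Q_next; set m := fun k => _.
have child k (r : rat) : {g : 'I_(m k) -> rat | denq r <= (Q k)%:Z ->
    close_children (radius tau (Q k)) r (Q k.+1) g}.
  apply: cid; have [rQ|] := boolP (denq r <= (Q k)%:Z);
    last by exists (fun=> 0).
  have [|||g gP] :=
    @close_children_exist R r (Q k) (Q k.+1) (m k) (radius tau (Q k)) rQ.
  - exact: radius_sqr_le1.
  - by apply: le_trans (Q_next k); rewrite ler_nat.
  - rewrite /m /branching truncn_le; have := radius_gt0 tau (Q_gt0 k).
    by have := sqr_ge0 ((Q k.+1)%:R : R); nra.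
  - by exists g.
exists (@tree_node m (fun k r => sval (child k r))).
by apply: rational_tree_node => // k r; exact: svalP (child k r).
Qed.

Lemma doubling_gt (Q : nat -> nat) :
  (0 < Q 0)%N -> (forall k, 2 * Q k <= Q k.+1)%N -> forall k, (k < Q k)%N.
Proof. by move=> Q0 Q_double; elim=> // k; have := Q_double k; lia. Qed.

Lemma halving_cvg0 (R : realType) (rho : nat -> R) :
  (forall k, 0 <= rho k) -> (forall k, rho k.+1 <= rho k / 2) ->
  rho @ \oo --> 0.
Proof.
move=> rho0 rho_half.
apply: (squeeze_cvgr (f := fun=> 0) (h := geometric (rho 0) 2^-1)).
- apply: nearW => k; rewrite rho0 /=.
  elim: k => [|k IH]; first by rewrite expr0 mulr1.
  by apply: le_trans (rho_half k) _; rewrite exprSr mulrA; lra.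
- exact: cvg_cst.
- by apply: cvg_geometric; rewrite ger0_norm; lra.
Qed.

Section LowerBound.
Context {R : realType} (tau u : R) (Q m : nat -> nat).
Context (y : forall k, address m k -> rat).
Hypotheses (tau_ge2 : 2 <= tau) (u_gt0 : 0 < u) (u_le1 : u <= 1).
Hypotheses (Q0 : Q 0%N = 1%N) (Q_double : forall k, (2 * Q k <= Q k.+1)%N).
Hypothesis tree : rational_tree tau Q y.

Local Notation rho k := (radius tau (Q k)).

Local Notation x := (fun k (w : address m k) => ratr (y w) : R).

Let Q_gt k : (k < Q k)%N.
Proof. by apply: doubling_gt; rewrite ?Q0. Qed.

Let Q_gt0 k : (0 < Q k)%N.
Proof. exact: leq_ltn_trans (Q_gt k). Qed.

Let rho_gt0 k : 0 < rho k.
Proof. exact: radius_gt0. Qed.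

Let rho_half k : rho k.+1 <= rho k / 2.
Proof.
apply: radius_double_le => //; apply: le_trans tau_ge2; exact: ler1n.
Qed.

Let child_close k (w : address m k.+1) :
  `|ratr (y w) - ratr (y w.1)| <= rho k / 4.
Proof.
rewrite ger0_norm ?(tree_child_close tree)// subr_ge0 ler_rat ltW//.
exact: tree_child_gt tree _ _.
Qed.

Lemma tree_separated k (v w : address m k) : v != w ->
  ((Q k)%:R ^+ 2)^-1 <= `|ratr (y v) - ratr (y w)| :> R.
Proof.
move=> vw; rewrite -[leLHS]mul1r ler_pdivrMr ?exprn_gt0 ?ltr0n// expr2.
apply: rat_separation (tree_denq_le tree v) (tree_denq_le tree w).
by apply: contra_neq vw; exact: tree_inj tree _ _ _.
Qed.

Lemma tree_denq_gt k (w : address m k.+1) : (Q k)%:Z < denq (y w).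
Proof.
rewrite ltNge; apply/negP => small.
have neq : y w != y w.1 by rewrite gt_eqF// (tree_child_gt tree).
have := rat_separation R neq small (tree_denq_le tree w.1).
rewrite leNgt => /negP[]; rewrite -expr2.
apply: (@le_lt_trans _ _ (rho k / 4 * (Q k)%:R ^+ 2)).
  by rewrite ler_wpM2r ?sqr_ge0.
by have := radius_sqr_le1 tau_ge2 (Q_gt0 k); lra.
Qed.

Context (d : nat).

Definition tree_point k (f : {ffun 'I_d -> address m k}) : 'rV[R]_d :=
  \row_i ratr (y (f i)).

Lemma kuratowski_limsup_approx (p : 'rV[R]_d) k :
  kuratowski_limsup tree_point p ->
  exists v : {ffun 'I_d -> address m k},
    forall i, `|p ord0 i - ratr (y (v i))| < rho k.
Proof.
move=> /(_ k I)/(_ _ (nbhsx_ballx p (rho k / 4) _)).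
move=> [|_ [[l kl [f _ <-]] near_p]].
  by rewrite divr_gt0.
have /choice[v vP] : forall i, exists v : address m k,
    `|ratr (y (f i)) - ratr (y v)| <= (rho k - rho l) / 2.
  by move=> i; exact: (@tree_ancestor R m x _ rho_half child_close).
exists [ffun i => v i] => i; rewrite ffunE.
have : `|p ord0 i - ratr (y (f i))| < rho k / 4.
  by have /ball_rVP[_ /(_ i)] := near_p; rewrite mxE.
have := ler_normD (p ord0 i - ratr (y (f i))) (ratr (y (f i)) - ratr (y (v i))).
by rewrite subrKA; have := vP i; have := rho_gt0 k; have := rho_gt0 l; lra.
Qed.

Lemma kuratowski_limsup_sub_S_max : (0 < d)%N ->
  kuratowski_limsup tree_point `<=` S_ theta_max tau.
Proof.
move=> d0 p limit_p; pose i0 := Ordinal d0.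
apply: (@infinite_set_unbounded _ _ (fun r => denominators r i0)) => n.
have [v vP] := kuratowski_limsup_approx n.+1 limit_p.
exists (\row_i y (v i)); last first.
  rewrite /denominators mxE -ltz_nat absz_denq (lt_trans _ (tree_denq_gt _))//.
  by rewrite ltz_nat Q_gt.
move=> i; rewrite mxE; apply: lt_le_trans (vP i) _.
set r := \row_i _; apply: radius_le.
- exact: le_trans tau_ge2.
- exact: leq_trans (denominators_gt0 r i0) (leq_bigmax i0).
- apply/bigmax_leqP => j _; rewrite -lez_nat absz_denq mxE.
  exact: (tree_denq_le tree).
Qed.

Context (C : R).
Hypothesis C_gt0 : 0 < C.
Hypothesis mass_ge1 : forall k, 1 <= #|address m k|%:R * rho k `^ u.
Hypothesis growth : forall k,
  #|address m k|%:R * rho k * (Q k.+1)%:R ^+ 2 <= C * #|address m k.+1|%:R.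

Lemma card_tree_point_ball_le k (c : 'rV[R]_d) (e : R) :
  (#|[set f : {ffun 'I_d -> address m k} |
      tree_point f \in (ball c e : set 'rV[R]_d)]%SET| <=
   \prod_(i < d) near_count x k (c ord0 i) e)%N.
Proof.
pose near i := [pred w : address m k | `|x k w - c ord0 i| <= e].
apply: (@leq_trans #|family near|).
  apply: subset_leq_card; apply/fintype.subsetP => f.
  rewrite !inE => /ball_rVP[_ f_c]; apply/familyP => i.
  by rewrite inE distrC ltW//; have := f_c i; rewrite mxE.
rewrite card_family foldrE big_image /=; apply: leq_prod => i _.
by rewrite /near_count cardsE.
Qed.

Lemma level_mass_ball_tree_point k (c : 'rV[R]_d) (e : R) : rho k <= e ->
  level_mass tree_point k (ball c e) <= (3 * C + 1) ^+ d * e `^ (u * d%:R).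
Proof.
move=> ke; have Nk0 := card_address_gt0 mass_ge1 k.
rewrite /level_mass card_ffun card_ord natrX ler_pdivrMr ?exprn_gt0//.
apply: (@le_trans _ _ (\prod_(i < d) (near_count x k (c ord0 i) e)%:R)).
  by rewrite -natr_prod ler_nat card_tree_point_ball_le.
apply: (@le_trans _ _
    (\prod_(i < d) ((3 * C + 1) * (#|address m k|%:R * e `^ u)))).
  apply: ler_prod => i _; rewrite ler0n /=.
  apply: (near_count_le_powR rho_half child_close
    (delta := fun k => ((Q k)%:R ^+ 2)^-1)) => //.
  - by rewrite Q0 radius1.
  - by move=> j; rewrite invr_gt0 exprn_gt0// ltr0n.
  - exact: tree_separated.
  - move=> j; rewrite mulrCA -ler_pdivrMl ?invr_gt0 ?exprn_gt0 ?ltr0n//.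
    by rewrite invrK mulrC.
rewrite prodr_const card_ord !exprMn powRrM powR_mulrn ?powR_ge0//.
by rewrite mulrA [leRHS]mulrAC.
Qed.

Lemma hausdorff_measure_S_max_gt0 : (0 < d)%N ->
  (0 < hausdorff_measure euclidean_dist (u * d%:R) (@S_ R d theta_max tau))%E.
Proof.
move=> d0; have K0 : 0 < (3 * C + 1) ^+ d.
  by rewrite exprn_gt0//; have := C_gt0; lra.
apply: (@lt_le_trans _ _ (((3 * C + 1) ^+ d)^-1)%:E).
  by rewrite lte_fin invr_gt0.
pose root : R := ratr (y (tt : address m 0)).
pose box : set 'rV[R]_d :=
  [set p | forall i, `[root - 1, root + 1]%classic (p ord0 i)].
have in_box k (f : {ffun 'I_d -> address m k}) : box (tree_point f).
  move=> i; rewrite mxE /= in_itv /=.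
  have [[] v_root] :=
    @tree_ancestor R m x _ rho_half child_close 0 k (f i) (leq0n k).
  by move: v_root; rewrite ler_norml Q0 radius1; have := rho_gt0 k; lra.
have compact_box : compact box.
  apply: (@rV_compact _ _ (fun=> `[root - 1, root + 1]%classic)) => i.
  exact: segment_compact.
have nodes_gt0 k : (0 < #|{ffun 'I_d -> address m k}|)%N.
  by rewrite card_ffun expn_gt0 -(ltr0n R) (card_address_gt0 mass_ge1).
have rho_cvg0 := halving_cvg0 (fun k => ltW (rho_gt0 k)) rho_half.
apply: (mass_distribution euclidean_dist_ge0 euclidean_dist_lt_ball nodes_gt0
  K0 _ rho_cvg0 level_mass_ball_tree_point compact_box in_box).
- by rewrite mulr_gt0// ltr0n.
- exact: kuratowski_limsup_sub_S_max.
Qed.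

End LowerBound.

Lemma hausdorff_dim_S_max_ge (R : realType) (d : nat) (tau : R) :
  (0 < d)%N -> 2 <= tau ->
  ((2 * d%:R / tau)%:E <=
   hausdorff_dim euclidean_dist (@S_ R d theta_max tau))%E.
Proof.
move=> d0 tau2; apply: hausdorff_dim_ge => [|s /andP[s0 s_lt]].
  exact: euclidean_dist_ge0.
have dR : 0 < d%:R :> R by rewrite ltr0n.
pose u := s / d%:R; have u0 : 0 < u by rewrite divr_gt0.
have tau_u : tau * u < 2.
  by move: s_lt; rewrite ltr_pdivlMr ?mulrA ?ltr_pdivrMr 1?(mulrC tau)//; lra.
have u1 : u <= 1 by nra.
have [Q Q0 QP] := scales_exist tau_u.
have Q_double k : (2 * Q k <= Q k.+1)%N by have [] := QP k.
have Q_gt0 k : (0 < Q k)%N.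
  by apply: leq_ltn_trans (doubling_gt _ Q_double k); rewrite ?Q0.
have Q_next k : 800 <= radius tau (Q k) * (Q k.+1)%:R by have [] := QP k.
have [y tree] := rational_tree_exists tau2 Q_gt0 Q_next.
rewrite (_ : s = u * d%:R); last by rewrite divfK ?gt_eqF.
apply: (hausdorff_measure_S_max_gt0 tau2 u0 u1 Q0 Q_double tree
  (C := 1600) _ _ _ d0).
- by rewrite ltr0n.
- elim=> [|k IH]; first by rewrite /= card_unit Q0 radius1 powR1 mulr1.
  have [_ _ mass_next] := QP k; apply: (le_trans mass_next).
  rewrite ler_wpM2r ?powR_ge0// ler_nat card_addressS leq_pmull// lt0n.
  by apply: contraTneq IH => ->; rewrite mul0r -ltNge ltr01.
- move=> k; rewrite card_addressS natrM -mulrA [leRHS]mulrCA.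
  by apply: ler_wpM2l; [exact: ler0n|exact: branching_ge].
Qed.

(** * The upper bound *)

Section RationalWeights.
Context {R : realType}.
Implicit Type kappa : R.

Lemma sum_powRN_dyadic_le kappa (k : nat) : 0 <= kappa ->
  \sum_(1 <= n < 2 ^ k) n%:R `^ (- kappa) <=
  \sum_(j < k) (2 `^ (1 - kappa)) ^+ j.
Proof.
move=> kappa0; elim: k => [|k IH]; first by rewrite expn0 big_geq// big_ord0.
have pow_ge1 : (1 <= 2 ^ k)%N by rewrite expn_gt0.
rewrite big_ord_recr /= (big_cat_nat pow_ge1) ?leq_exp2l//=; apply: lerD => //.
have -> : (2 `^ (1 - kappa)) ^+ k =
    \sum_(2 ^ k <= n < 2 ^ k.+1) (2 ^ k)%:R `^ (- kappa) :> R.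
  rewrite sumr_const_nat expnS mul2n -addnn addnK.
  rewrite -powR_mulrn ?powR_ge0// -powRrM.
  rewrite mulrBl mul1r powRD; last by rewrite pnatr_eq0 implybT.
  rewrite powR_mulrn// -[RHS]mulr_natl !natrX; congr (_ * _).
  by rewrite -powR_mulrn// -powRrM mulrN mulrC.
rewrite big_nat [leRHS]big_nat; apply: ler_sum => n /andP[kn _].
by apply: ler_powRN; rewrite ?ltr0n ?expn_gt0 ?ler_nat.
Qed.

Lemma bounded_sums_powRN kappa : 1 < kappa ->
  bounded_sums (fun n : nat => n.+1%:R `^ (- kappa)).
Proof.
move=> kappa1; set x : R := 2 `^ (1 - kappa).
have x0 : 0 < x by rewrite powR_gt0.
have x1 : x < 1.
  have : 1 `^ (kappa - 1) < 2 `^ (kappa - 1) :> R.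
    by rewrite gt0_ltr_powR ?nnegrE ?ltr1n ?subr_gt0.
  by rewrite powR1 => ?; rewrite /x -opprB powRN invf_lt1 ?powR_gt0.
exists (1 / (1 - x)) => js ujs; pose N := (\max_(n <- js) n).+1.
apply: (@le_trans _ _ (\sum_(n <- index_iota 0 N) n.+1%:R `^ (- kappa))).
  apply: (ler_sum_uniq_sub _ ujs (iota_uniq _ _)) => [n|n n_js].
    exact: powR_ge0.
  by rewrite mem_iota subn0 add0n ltnS leq_bigmax_seq.
have N_le : (N.+1 <= 2 ^ N.+1)%N by rewrite ltnW// ltn_expl.
apply: (@le_trans _ _ (\sum_(1 <= n < 2 ^ N.+1) n%:R `^ (- kappa))).
  rewrite (big_cat_nat _ N_le)//= big_add1 lerDl.
  by rewrite sumr_ge0// => n _; rewrite powR_ge0.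
apply: (le_trans (sum_powRN_dyadic_le _ _)); first lra.
have := @geometric_le_lim R N.+1 1 x ler01 x0.
rewrite ger0_norm ?(ltW x0)// => /(_ x1); apply: le_trans.
by rewrite /series /= big_mkord ler_sum// => j _; rewrite mul1r.
Qed.

Definition rat_weight kappa (r : rat) : R :=
  `|denq r|%:R `^ (- kappa) * `|numq r|.+1%:R `^ (- kappa).

Lemma bounded_sums_rat_weight kappa : 1 < kappa ->
  bounded_sums (rat_weight kappa).
Proof.
move=> kappa1; pose w (n : nat) : R := n.+1%:R `^ (- kappa).
have w0 n : 0 <= w n by exact: powR_ge0.
pose code (r : rat) := (numq r < 0, (`|denq r|.-1, `|numq r|%N)).
have denq_pred (r : rat) : `|denq r|.-1.+1 = `|denq r|%N.
  by rewrite prednK// absz_gt0 denq_neq0.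
apply: (@bounded_sums_inj _ _ _ code _ (fun c => 1 * (w c.2.1 * w c.2.2))).
- move=> r s [sgn /(congr1 succn)]; rewrite !denq_pred => den num.
  rewrite -[r]divq_num_den -[s]divq_num_den; congr (_%:~R / _%:~R).
    by rewrite [LHS]intEsign [RHS]intEsign sgn num.
  by rewrite -[LHS]absz_denq -[RHS]absz_denq den.
- by move=> r; rewrite /rat_weight /w /= denq_pred mul1r.
- apply: (@bounded_sums_pair _ _ _ (fun=> 1) (fun c => w c.1 * w c.2))
    => [_|c||].
  + exact: ler01.
  + exact: mulr_ge0.
  + by apply: bounded_sums_finType => _; exact: ler01.
  + by apply: bounded_sums_pair => //; exact: bounded_sums_powRN.
Qed.

End RationalWeights.

Lemma prod_powR (R : realType) (I : finType) (f : I -> R) (a : R) :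
  (forall i, 0 <= f i) -> \prod_i f i `^ a = (\prod_i f i) `^ a.
Proof.
move=> f0.
suff [] : \prod_i f i `^ a = (\prod_i f i) `^ a /\ 0 <= \prod_i f i by [].
apply: (big_rec2 (fun b c => b = c `^ a /\ 0 <= c)); first by rewrite powR1.
by move=> i b c _ [-> c0]; rewrite powRM// mulr_ge0.
Qed.

Lemma natr_absz_numq (R : numFieldType) (r : rat) :
  `|numq r|%:R = `|ratr r| * `|denq r|%:R :> R.
Proof.
by rewrite !natr_absz !intr_norm -normrM -!(ratr_int R) numqE rmorphM.
Qed.

Lemma rat_weight_ge (R : realType) (kappa B : R) (r : rat) :
  0 <= kappa -> `|ratr r| <= B ->
  (1 + B) `^ (- kappa) * `|denq r|%:R `^ (- (2 * kappa)) <= rat_weight kappa r.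
Proof.
move=> kappa0 rB; have B0 : 0 <= B by exact: le_trans rB.
have q1 : 1 <= `|denq r|%:R :> R by rewrite ler1n absz_gt0 denq_neq0.
have -> : `|denq r|%:R `^ (- (2 * kappa)) =
    `|denq r|%:R `^ (- kappa) * `|denq r|%:R `^ (- kappa) :> R.
  rewrite -powRD; last by rewrite implybE pnatr_eq0 absz_eq0 denq_neq0 orbT.
  by congr (_ `^ _); ring.
rewrite mulrCA ler_wpM2l ?powR_ge0// -powRM ?ler0n//; last lra.
have num_le : `|numq r|.+1%:R <= (1 + B) * `|denq r|%:R :> R.
  have : `|numq r|%:R <= B * `|denq r|%:R :> R.
    by rewrite natr_absz_numq ler_wpM2r.
  by rewrite -natr1; lra.
exact: ler_powRN.
Qed.

Section UpperBound.
Context {R : realType} {d : nat} (tau : R).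
Implicit Types (r : 'rV[rat]_d) (x : 'rV[R]_d).

Definition den_prod r : nat := \prod_i denominators r i.

Definition prod_radius r : R := theta_prod (denominators r) `^ (- tau).

Definition approx_box r : set 'rV[R]_d :=
  [set x | forall i, `|x ord0 i - ratr (r ord0 i)| < prod_radius r].

Definition rat_row_weight (kappa : R) r : R :=
  \prod_i rat_weight kappa (r ord0 i).

Lemma den_prod_gt0 r : (0 < den_prod r)%N.
Proof. by apply: prodn_gt0 => i; exact: denominators_gt0. Qed.

Lemma rat_row_weight_ge (kappa B : R) r :
  0 <= kappa -> (forall i, `|ratr (r ord0 i)| <= B) ->
  ((1 + B) `^ (- kappa)) ^+ d * (den_prod r)%:R `^ (- (2 * kappa)) <=
  rat_row_weight kappa r.
Proof.
move=> kappa0 rB; rewrite natr_prod -prod_powR//.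
rewrite -[X in _ ^+ X]card_ord -prodr_const -big_split; apply: ler_prod => i _.
by rewrite mulr_ge0 ?powR_ge0//= rat_weight_ge.
Qed.

Lemma prod_radiusE r : prod_radius r = (den_prod r)%:R `^ (- (tau / d%:R)).
Proof. by rewrite /prod_radius /theta_prod -powRrM mulrN mulrC. Qed.

Lemma prod_radius_ge0 r : 0 <= prod_radius r.
Proof. exact: powR_ge0. Qed.

Lemma diameter_approx_box r :
  (diameter euclidean_dist (approx_box r) <= (d%:R * (2 * prod_radius r))%:E)%E.
Proof.
apply: ge_ereal_sup => _ [x [y [xr yr ->]]]; rewrite lee_fin.
apply: euclidean_dist_le => [|i]; first by rewrite mulr_ge0 ?prod_radius_ge0.
have := ler_normD (x ord0 i - ratr (r ord0 i)) (ratr (r ord0 i) - y ord0 i).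
by rewrite subrKA; have := xr i; have := yr i; rewrite (distrC (y ord0 i)); lra.
Qed.

Hypothesis tau_ge0 : 0 <= tau.

Lemma prod_radius_le1 r : prod_radius r <= 1.
Proof.
rewrite prod_radiusE powRN invf_le1 ?powR_gt0 ?ltr0n ?den_prod_gt0//.
rewrite -[leLHS](powRr0 (den_prod r)%:R).
by rewrite ler_powR ?ler1n ?den_prod_gt0 ?divr_ge0.
Qed.

Lemma approx_box_coord_le r x : approx_box r x ->
  forall i, `|ratr (r ord0 i)| <= 1 + \sum_j `|x ord0 j|.
Proof.
move=> rx i; have : `|x ord0 i| <= \sum_j `|x ord0 j|.
  by rewrite (bigD1 i)//= lerDl sumr_ge0.
have := ler_normD (ratr (r ord0 i) - x ord0 i) (x ord0 i); rewrite subrK distrC.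
by have := rx i; have := prod_radius_le1 r; lra.
Qed.

(* Vectors near [x] with bounded denominator product have weights bounded away
   from 0, so there are finitely many of them. *)
Lemma S_prod_den_prod_unbounded x (M : nat) : S_ theta_prod tau x ->
  exists2 r, approx_box r x & (M < den_prod r)%N.
Proof.
move=> xS; apply: contrapT => bounded; apply: xS.
pose B := 1 + \sum_j `|x ord0 j|.
pose c := ((1 + B) `^ (- 2)) ^+ d * M.+1%:R `^ (- (2 * 2)).
have B0 : 0 <= B by rewrite addr_ge0 ?sumr_ge0.
apply: (@sub_finite_set _ _ [set r | c <= rat_row_weight 2 r]) => [r rx|].
  have rM : (den_prod r <= M)%N.
    by rewrite leqNgt; apply/negP => Mr; apply: bounded; exists r.
  apply: le_trans (rat_row_weight_ge _ (approx_box_coord_le rx)) => //.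
  rewrite ler_wpM2l ?exprn_ge0 ?powR_ge0//.
  by apply: ler_powRN; rewrite ?ltr0n ?den_prod_gt0 ?ler_nat ?mulr_ge0// ltnW.
apply: finite_ge_bounded_sums.
- by rewrite mulr_gt0 ?exprn_gt0 ?powR_gt0// ltr_wpDr.
- apply: bounded_sums_row => [q|]; first by rewrite mulr_ge0 ?powR_ge0.
  by apply: bounded_sums_rat_weight; rewrite ltr1n.
Qed.

Lemma approx_box_eventually_small s kappa (eps delta : R) x :
  0 <= s -> 0 <= kappa -> 0 < tau / d%:R -> 2 * kappa < tau * s / d%:R ->
  0 < eps -> 0 < delta -> S_ theta_prod tau x ->
  exists r, [/\ approx_box r x,
    (d%:R * (2 * prod_radius r)) `^ s <= eps * rat_row_weight kappa r &
    d%:R * (2 * prod_radius r) <= delta].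
Proof.
move=> s0 kappa0 taud0 kappa_s eps0 delta0 xS.
pose b := ((1 + (1 + \sum_j `|x ord0 j|)) `^ (- kappa)) ^+ d.
have b0 : 0 < b by rewrite exprn_gt0// powR_gt0// ltr_wpDr// addr_ge0 ?sumr_ge0.
have gauge_small : \forall n \near \oo,
    (d%:R * 2) `^ s * n%:R `^ (- (tau * s / d%:R)) <=
    eps * b * n%:R `^ (- (2 * kappa)).
  by apply: near_infty_powRN_le => //; rewrite mulr_gt0.
have radius_small : \forall n \near \oo,
    d%:R * 2 * n%:R `^ (- (tau / d%:R)) <= delta * n%:R `^ (- 0).
  exact: near_infty_powRN_le.
have [N _ small] := filterI gauge_small radius_small.
have [r rx Nr] := S_prod_den_prod_unbounded N xS.
have [gauge_r radius_r] := small _ (ltnW Nr).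
exists r; rewrite mulrA prod_radiusE; split => //; last first.
  by move: radius_r; rewrite oppr0 powRr0 mulr1.
rewrite powRM ?powR_ge0 ?mulr_ge0// -powRrM.
rewrite (_ : - (tau / d%:R) * s = - (tau * s / d%:R)); last by ring.
apply: (le_trans gauge_r); rewrite -mulrA ler_pM2l//.
exact: rat_row_weight_ge (approx_box_coord_le rx).
Qed.

End UpperBound.

Lemma hausdorff_dim_S_prod_le (R : realType) (d : nat) (tau : R) :
  (0 < d)%N -> 0 < tau ->
  (hausdorff_dim euclidean_dist (@S_ R d theta_prod tau) <=
   (2 * d%:R / tau)%:E)%E.
Proof.
move=> d0 tau0; have dR : 0 < d%:R :> R by rewrite ltr0n.
have dim_ge0 : 0 <= 2 * d%:R / tau by rewrite divr_ge0 ?mulr_ge0// ltW.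
apply: hausdorff_dim_le => // s s_gt.
have s0 : 0 < s := le_lt_trans dim_ge0 s_gt.
set sigma := tau * s / d%:R.
have sigma2 : 2 < sigma.
  by move: s_gt; rewrite ltr_pdivrMr// /sigma ltr_pdivlMr// (mulrC s).
pose kappa := (1 + sigma / 2) / 2.
have [kappa1 kappa_sigma] : 1 < kappa /\ 2 * kappa < sigma.
  by rewrite /kappa; lra.
have w0 (r : 'rV[rat]_d) : 0 <= rat_row_weight kappa r.
  by apply: prodr_ge0 => i _; rewrite mulr_ge0 ?powR_ge0.
have bounded_w : bounded_sums (@rat_row_weight R d kappa).
  apply: bounded_sums_row (bounded_sums_rat_weight kappa1) => r.
  by rewrite mulr_ge0 ?powR_ge0.
apply: (hausdorff_measure_eq0 (E := approx_box tau) w0 bounded_w).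
move=> eps delta x eps0 delta0 xS.
have kappa0 : 0 <= kappa := le_trans ler01 (ltW kappa1).
have [r [rx gauge_r radius_r]] := approx_box_eventually_small (ltW tau0)
  (ltW s0) kappa0 (divr_gt0 tau0 dR) kappa_sigma eps0 delta0 xS.
exists r; split => //; have diam_r := diameter_approx_box tau r.
- by apply: le_trans diam_r _; rewrite lee_fin.
- apply: le_trans (gauge_le_powR (@euclidean_dist_ge0 R d) (ltW s0) diam_r) _.
  by rewrite lee_fin.
Qed.

(** * Comparison of the two heights *)

Lemma theta_prod_le_max (R : realType) (d : nat) (q : 'I_d -> nat) :
  (0 < d)%N -> theta_prod q <= theta_max q :> R.
Proof.
move=> d0; rewrite /theta_prod /theta_max; set m := \max_i q i.
have -> : m%:R = (m ^ d)%N%:R `^ d%:R^-1 :> R.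
  by rewrite natrX -powR_mulrn// -powRrM mulfV ?pnatr_eq0 -?lt0n// powRr1.
rewrite ge0_ler_powR ?nnegrE ?invr_ge0// ler_nat.
rewrite -[d in (m ^ d)%N]card_ord -prod_nat_const.
by apply: leq_prod => i _; exact: leq_bigmax.
Qed.

Lemma S_max_sub_S_prod (R : realType) (d : nat) (tau : R) :
  (0 < d)%N -> 0 <= tau ->
  @S_ R d theta_max tau `<=` S_ theta_prod tau.
Proof.
move=> d0 tau0 x; apply: sub_infinite_set => r rx i.
apply: (lt_le_trans (rx i)).
have prod_gt0 : 0 < theta_prod (denominators r) :> R.
  by rewrite powR_gt0// ltr0n den_prod_gt0.
exact: ler_powRN (theta_prod_le_max R (denominators r) d0) tau0.
Qed.

Theorem theorem1p3 (R : realType) (d : nat) (hd : (1 <= d)%N)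
    (Theta : ('I_d -> nat) -> R)
    (hTheta : Theta = theta_max \/ Theta = theta_prod)
    (tau : R) (htau : 2 <= tau) :
  hausdorff_dim euclidean_dist (S_ Theta tau) = (2 * d%:R / tau)%:E.
Proof.
have tau0 : 0 < tau by lra.
have lower := hausdorff_dim_S_max_ge hd htau.
have upper := hausdorff_dim_S_prod_le hd tau0.
have max_le_prod :=
  hausdorff_dim_subset euclidean_dist (S_max_sub_S_prod hd (ltW tau0)).
case: hTheta => ->; apply/le_anti/andP; split.
- exact: le_trans max_le_prod upper.
- exact: lower.
- exact: upper.
- exact: le_trans lower max_le_prod.
Qed.
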